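(* Let $d\ge1$ and $\tau\ge1$. If $\alpha>0$, then there is a constant $C$ such that for all $f \in L_1(\mathbb{T}^d)$, $$\sup_{\rho >0} \rho\, \lambda(\sigma^\alpha_\Box f > \rho) \leq C \|f\|_{1}.$$
   Context: $\mathbb{T}=[-\pi,\pi]$ is the torus and $\lambda$ is Lebesgue measure. For $f\in L_1(\mathbb{T}^d)$, $\widehat f(k)=(2\pi)^{-d}\int_{\mathbb{T}^d} f(x)e^{-\imath k\cdot x}\,dx$, $k\in\mathbb{Z}^d$ ($\imath=\sqrt{-1}$). Fix a real parameter $1\le\gamma<\infty$. The rectangular Riesz means, for $n\in\mathbb{N}^d$ with all $n_i\ge1$, are $$\sigma_n^{\alpha}f(x)=\sum_{|k_1|\le n_1}\cdots\sum_{|k_d|\le n_d}\prod_{i=1}^d\Big(1-\Big(\frac{|k_i|}{n_i}\Big)^\gamma\Big)^\alpha\widehat f(k)e^{\imath k\cdot x}.$$ For $\tau\ge1$ the cone is $\mathbb{R}_\tau^d=\{x\in(0,\infty)^d:\tau^{-1}\le x_i/x_j\le\tau,\ i,j=1,\ldots,d\}$, and the restricted maximal operator is $\sigma_\Box^\alpha f=\sup_{n\in\mathbb{R}_\tau^d\cap\mathbb{N}^d}|\sigma_n^\alpha f|$. *)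

(* Defs.v *)
From HB Require Import structures.
From mathcomp Require Import all_boot all_order all_algebra.
From mathcomp Require Import all_classical all_reals all_analysis.
From mathcomp Require Import complex.

Set Implicit Arguments.
Unset Strict Implicit.
Unset Printing Implicit Defensive.

Import Order.TTheory GRing.Theory Num.Theory.
Import numFieldNormedType.Exports.
Import ComplexField.Normc.

Local Open Scope classical_set_scope.
Local Open Scope complex_scope.
Local Open Scope ring_scope.

(* Points of R^d are d-tuples. The library's sigma-algebra on d.-tuple R is
   the product of the Borel sigma-algebras, that is, the Borel sigma-algebra
   of R^d. Lebesgue measure on R^d is built by recursion on d: the image of
   the product measure under (x, t) |-> x :: t, starting from the unit mass
   on the one-point space R^0. Lemma lebesgue_tuple_box characterizes it. *)
Section lebesgue_tuple.
Context {R : realType}.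
Local Open Scope ereal_scope.

Definition cons_tuple_pair n (p : R * n.-tuple R) : n.+1.-tuple R :=
  [tuple of p.1 :: p.2].

Lemma measurable_cons_tuple_pair n :
  measurable_fun [set: R * n.-tuple R] (@cons_tuple_pair n).
Proof. exact: measurable_cons. Qed.

Definition uncons_tuple_pair n (t : n.+1.-tuple R) : R * n.-tuple R :=
  (thead t, [tuple of behead t]).

Lemma measurable_uncons_tuple_pair n :
  measurable_fun [set: n.+1.-tuple R] (@uncons_tuple_pair n).
Proof.
by apply/measurable_fun_pairP; split;
  [exact: measurable_tnth|exact: measurable_behead].
Qed.

Lemma cons_tuple_pairK n : cancel (@cons_tuple_pair n) (@uncons_tuple_pair n).
Proof. by case=> x t; congr pair; exact/val_inj. Qed.

Section lebesgue_cons.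
Variables (n : nat) (mu : {sigma_finite_measure set (n.-tuple R) -> \bar R}).

Definition lebesgue_cons : set (n.+1.-tuple R) -> \bar R :=
  pushforward (@lebesgue_measure R \x mu) (@cons_tuple_pair n).

Let lebesgue_cons0 : lebesgue_cons set0 = 0.
Proof. by rewrite /lebesgue_cons /pushforward preimage_set0 measure0. Qed.

Let lebesgue_cons_ge0 A : 0 <= lebesgue_cons A.
Proof. exact: (measure_ge0 (@lebesgue_measure R \x mu)). Qed.

Let lebesgue_cons_sigma_additive : semi_sigma_additive lebesgue_cons.
Proof.
have mf := @measurable_cons_tuple_pair n.
move=> F mF tF mUF; rewrite /lebesgue_cons /pushforward preimage_bigcup.
apply: measure_semi_sigma_additive.
- by move=> k; rewrite -[X in measurable X]setTI; exact: mf.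
- apply/trivIsetP => /= i j _ _ ij; rewrite -preimage_setI.
  by move/trivIsetP : tF => /(_ _ _ _ _ ij) ->//; rewrite preimage_set0.
- by rewrite -preimage_bigcup -[X in measurable X]setTI; exact: mf.
Qed.

HB.instance Definition _ := isMeasure.Build _ _ _ lebesgue_cons
  lebesgue_cons0 lebesgue_cons_ge0 lebesgue_cons_sigma_additive.

Let lebesgue_cons_sigma_finite : sigma_finite setT lebesgue_cons.
Proof.
have /sigma_finiteP[F [TF ndF Foo]] := sigma_finiteT (@lebesgue_measure R).
have /sigma_finiteP[G [TG ndG Goo]] := sigma_finiteT mu.
exists (fun k => @uncons_tuple_pair n @^-1` (F k `*` G k)).
  rewrite -preimage_bigcup -[LHS](preimage_setT (@uncons_tuple_pair n)).
  congr preimage; apply/seteqP; split=> // -[x y] _.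
  have [j _ Fx] : (\bigcup_k F k) x by rewrite -TF.
  have [k _ Gy] : (\bigcup_k G k) y by rewrite -TG.
  exists (maxn j k) => //; split.
  - by move: x Fx; exact/subsetPset/ndF/leq_maxl.
  - by move: y Gy; exact/subsetPset/ndG/leq_maxr.
move=> k; have [? ?] := Foo k; have [? ?] := Goo k; split.
  rewrite -[X in measurable X]setTI.
  by apply: measurable_uncons_tuple_pair => //; exact: measurableX.
rewrite /lebesgue_cons /pushforward -comp_preimage.
rewrite (_ : _ \o _ = id) ?preimage_id; last exact/funext/cons_tuple_pairK.
by rewrite product_measure1E// lte_mul_pinfty// ge0_fin_numE.
Qed.

HB.instance Definition _ := Measure_isSigmaFinite.Build _ _ _ lebesgue_cons
  lebesgue_cons_sigma_finite.

End lebesgue_cons.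

Fixpoint lebesgue_tuple n : {sigma_finite_measure set (n.-tuple R) -> \bar R} :=
  match n with
  | 0 => \d_ ([tuple] : 0.-tuple R)
  | n.+1 => lebesgue_cons (lebesgue_tuple n)
  end.

Lemma lebesgue_tuple_box n (A : 'I_n -> set R) :
  (forall i, measurable (A i)) ->
  lebesgue_tuple n [set t | forall i, A i (tnth t i)] =
  \prod_(i < n) lebesgue_measure (A i).
Proof.
elim: n A => [|n IH] A mA.
  by rewrite big_ord0 /= diracE mem_set//= => -[].
rewrite big_ord_recl -(IH (fun i => A (lift ord0 i)))//=.
rewrite /lebesgue_cons /pushforward -product_measure1E//=.
  congr product_measure1; apply/seteqP; split => -[x t]/=.
    move=> xtA; split; first by have := xtA ord0; rewrite tnth0.
    by move=> i; have := xtA (lift ord0 i); rewrite tnthS.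
  move=> [Ax At] i; case: (unliftP ord0 i) => [j|] ->; last by rewrite tnth0.
  by rewrite tnthS.
  exact: mA.
rewrite (_ : [set t | _] = \bigcap_(i : 'I_n)
    ((fun t => tnth t i) @^-1` A (lift ord0 i))).
  apply: fin_bigcap_measurable => // i _; rewrite -[X in measurable X]setTI.
  exact: measurable_tnth.
by apply/seteqP; split=> t /= tA i; [move=> _|]; exact: tA.
Qed.

End lebesgue_tuple.

Section riesz_means.
Context {R : realType} {d : nat}.
Implicit Types (f : d.-tuple R -> R[i]) (x : d.-tuple R) (k : d.-tuple int)
  (n : d.-tuple nat).

Definition torus : set (d.-tuple R) :=
  [set x | forall i, - pi <= tnth x i <= pi].

(* L_1(T^d): functions are defined on R^d but only their values on T^d matter.
   Every class of L_1(T^d) has a Borel representative, and everything below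
   depends only on the class. *)
Definition L1_torus : set (d.-tuple R -> R[i]) :=
  [set f | (lebesgue_tuple d).-integrable torus (fun x => (complex.Re (f x))%:E)
    /\ (lebesgue_tuple d).-integrable torus (fun x => (complex.Im (f x))%:E)].

Definition L1_norm f : \bar R :=
  (\int[lebesgue_tuple d]_(x in torus) (normc (f x))%:E)%E.

Definition torus_integral f : R[i] :=
  (\int[lebesgue_tuple d]_(x in torus) complex.Re (f x))%R +i*
  (\int[lebesgue_tuple d]_(x in torus) complex.Im (f x))%R.

(* exp (i t) *)
Definition expi (t : R) : R[i] := cos t +i* sin t.

Definition dot k x : R := \sum_(i < d) (tnth k i)%:~R * tnth x i.

Definition fourier_coef f k : R[i] :=
  (((2 * pi) ^- d)%:C) * torus_integral (fun x => f x * expi (- dot k x)).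

(* The index set {k in Z^d : |k_i| <= n_i} of the sum is finite, as the
   finitely supported sum over it requires in order to be the actual sum. *)
Definition riesz_mean (gamma alpha : R) n f x : R[i] :=
  \sum_(k \in [set k : d.-tuple int | forall i, (`|tnth k i| <= tnth n i)%N])
    ((\prod_(i < d)
        (1 - (`|(tnth k i)%:~R| / (tnth n i)%:R) `^ gamma) `^ alpha)%:C
     * fourier_coef f k * expi (dot k x)).

Definition cone (tau : R) : set (d.-tuple R) :=
  [set x | (forall i, 0 < tnth x i) /\
           (forall i j, tau^-1 <= tnth x i / tnth x j <= tau)].

Definition riesz_maximal (gamma alpha tau : R) f x : \bar R :=
  ereal_sup [set (normc (riesz_mean gamma alpha n f x))%:E
            | n in [set n | cone tau [tuple (tnth n i)%:R | i < d]]].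

End riesz_means.

(* Main.v *)
Require Import Defs.
From HB Require Import structures.
From mathcomp Require Import all_boot all_order all_algebra.
From mathcomp Require Import all_classical all_reals all_analysis.
From mathcomp Require Import measurable_realfun complex ring lra zify.

(** In one variable the kernel of the Riesz mean of order n is the cosine sum K_n
    whose coefficients sample the function (1 - s ^ gamma) ^ alpha at k / n.
    Summation by parts turns K_n u * sin (u / 2) into a sine sum whose
    coefficients are the drops of the samples.  Multiplying it by
    sin (h u / 2), for an integer h of the order of 1 / u, leaves the variation
    of the drops at lag h (cos_kernel_lag).  If alpha <= 1 the sampled function
    is concave, the drops are monotone, and this variation telescopes to
    O((h / n) ^ alpha).  For a larger alpha the function is an integral power of
    a concave one, and a Leibniz rule for the variation at lag h (profileM)
    gives O((h / n) ^ b) with some b > 0.  Hence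
    |K_n u| <= C |u| ^ -1 (n |u|) ^ -b (riesz_kernel_decay).  Any b > 0 is
    enough for what follows.

    The kernel in d variables is the product of the K_(n_i) (x_i - t_i), and in
    the cone all the n_i are comparable to one power 2 ^ l.  It has no
    integrable radially decreasing majorant for small b, so it is cut
    dyadically in each coordinate separately: when x_i - t_i is of the order of
    2 ^ (j_i - l), modulo a period, the point t lies in a cell of a grid of
    sides 2 ^ (j_i - l), next to the cell of x, and the kernel is at most
    C / (volume of the cell) times a factor that decreases geometrically in
    each j_i (riesz_kernel_cell).  The Riesz means are thus bounded by sums over
    the exponents j of averages of |f| over cells, with geometric weights.

    For fixed j the cells form, as l varies, a one-parameter family of nested
    dyadic grids.  The maximal cells on which the average of |f| exceeds a
    threshold are disjoint, so that the corresponding maximal operator has weak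
    type (1,1) with a constant that does not depend on j (cover_heavy).  It
    remains to add these operators over j.  If the sum exceeds rho, then for
    some j the term of index j exceeds rho times its share (sum_cells); half of
    the geometric decay makes the shares sum to at most 1, and the other half
    makes the measures of the exceptional sets summable (level_set_cover).
    Everything is done for finitely many levels l < L, with bounds independent
    of L, and L tends to infinity at the end (maximal_weak_type). *)

Import Order.TTheory GRing.Theory Num.Theory.
Import numFieldNormedType.Exports.
Import ComplexField.Normc.

Set Implicit Arguments.
Unset Strict Implicit.
Unset Printing Implicit Defensive.

Local Open Scope classical_set_scope.
Local Open Scope ring_scope.

(** * Coefficient sequences with controlled second differences *)

Section profiles.
Context {R : realType}.
Implicit Types (c : nat -> R) (h n k m : nat) (w W : R).

Definition drop_at c k : R := c k - c k.+1.

Lemma sum_drop_at c m : \sum_(k < m) drop_at c k = c 0%N - c m.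
Proof.
rewrite -(big_mkord xpredT (drop_at c)).
rewrite (@telescope_sumr_eq _ 0 m (fun k => - c k)) ?opprK 1?addrC//.
by move=> i _; rewrite /drop_at opprK addrC.
Qed.

(** The data about a coefficient sequence that the kernel estimate uses.  The
    last bound is on the variation of the drops at lag h, a discrete substitute
    for the modulus of continuity in L^1 of the derivative.  Unlike concavity,
    these four properties survive products. *)
Definition profile h w W c :=
  [/\ forall k, 0 <= c k <= 1,
      forall k, c k.+1 <= c k,
      forall k, c k - c (k + h)%N <= w &
      forall m, \sum_(k < m) `|drop_at c (k + h)%N - drop_at c k| <= W].

Lemma profile_homo h w W c : profile h w W c -> nonincreasing_seq c.
Proof. by move=> [_ dc _ _]; apply/nonincreasing_seqP. Qed.

(** A Leibniz rule: the double difference of a product is the sum of two terms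
    with a double difference of one factor, and of two terms with a difference
    at lag h of one factor and a drop of the other.  The drops sum to at most 1
    since the sequences decrease inside [0, 1]. *)
Lemma profileM h w1 W1 w2 W2 c1 c2 :
  profile h w1 W1 c1 -> profile h w2 W2 c2 ->
  profile h (w1 + w2) (W1 + W2 + w1 + w2) (fun k => c1 k * c2 k).
Proof.
move=> p1 p2; have h1 := profile_homo p1; have h2 := profile_homo p2.
move: p1 p2 => [b1 d1 m1 v1] [b2 d2 m2 v2].
have w10 : 0 <= w1 by apply: le_trans (m1 0%N); rewrite subr_ge0 h1.
have w20 : 0 <= w2 by apply: le_trans (m2 0%N); rewrite subr_ge0 h2.
split=> [k|k|k|m].
- have /andP[? ?] := b1 k; have /andP[? ?] := b2 k.
  by rewrite mulr_ge0//= mulr_ile1.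
- have /andP[? ?] := b1 k.+1; have /andP[? ?] := b2 k.+1.
  exact: ler_pM.
- have /andP[? ?] := b1 k; have /andP[? ?] := b2 (k + h)%N.
  have -> : c1 k * c2 k - c1 (k + h)%N * c2 (k + h)%N =
    c1 k * (c2 k - c2 (k + h)%N) + (c1 k - c1 (k + h)%N) * c2 (k + h)%N by ring.
  rewrite [leRHS]addrC lerD//.
    apply: le_trans (m2 k); apply: ler_piMl => //.
    by rewrite subr_ge0 h2// leq_addr.
  apply: le_trans (m1 k); apply: ler_piMr => //.
  by rewrite subr_ge0 h1// leq_addr.
apply: (@le_trans _ _ (\sum_(k < m)
    (`|drop_at c1 (k + h)%N - drop_at c1 k|
    + `|drop_at c2 (k + h)%N - drop_at c2 k|
    + w1 * drop_at c2 k + w2 * drop_at c1 k))).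
  apply: ler_sum => -[k /= _] _.
  have -> : drop_at (fun k => c1 k * c2 k) (k + h)%N
          - drop_at (fun k => c1 k * c2 k) k =
      (drop_at c1 (k + h)%N - drop_at c1 k) * c2 (k.+1 + h)%N
    + c1 (k + h)%N * (drop_at c2 (k + h)%N - drop_at c2 k)
    - (c1 k - c1 (k + h)%N) * drop_at c2 k
    - (c2 k.+1 - c2 (k.+1 + h)%N) * drop_at c1 k.
    by rewrite /drop_at addSn; ring.
  have g1 : 0 <= drop_at c1 k by rewrite subr_ge0 d1.
  have g2 : 0 <= drop_at c2 k by rewrite subr_ge0 d2.
  apply: le_trans (ler_normB _ _) _; apply: lerD; last first.
    by rewrite normrM (ger0_norm g1) ler_wpM2r// ger0_norm// subr_ge0 h2// leq_addr.
  apply: le_trans (ler_normB _ _) _; apply: lerD; last first.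
    by rewrite normrM (ger0_norm g2) ler_wpM2r// ger0_norm// subr_ge0 h1// leq_addr.
  - apply: le_trans (ler_normD _ _) _; rewrite !normrM; apply: lerD.
      by apply: ler_piMr => //; have /andP[? ?] := b2 (k.+1 + h)%N;
         rewrite ger0_norm.
    by apply: ler_piMl => //; have /andP[? ?] := b1 (k + h)%N;
       rewrite ger0_norm.
rewrite !big_split/= -!mulr_sumr !sum_drop_at.
apply: lerD; first apply: lerD; first exact: lerD (v1 m) (v2 m).
  by apply: ler_piMr => //; have := b2 0%N; have := b2 m; lra.
by apply: ler_piMr => //; have := b1 0%N; have := b1 m; lra.
Qed.

(** The quadratic constant only has to satisfy
    (m + 4) ^ 2 >= 2 and (m + 5) ^ 2 >= (m + 4) ^ 2 + 2 + (m + 1) + 1. *)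
Lemma profileX h w W c m : profile h w W c -> W <= 2 * w ->
  profile h (m.+1%:R * w) ((m%:R + 4) ^+ 2 * w) (fun k => c k ^+ m.+1).
Proof.
move=> pc Ww.
have w0 : 0 <= w.
  have hc := profile_homo pc; have [_ _ mc _] := pc.
  by apply: le_trans (mc 0%N); rewrite subr_ge0 hc.
elim: m => [|m IH].
  have [bc dc mc vc] := pc; split=> [k|k|k|m]; rewrite ?expr1 ?mul1r//.
  under eq_bigr do rewrite /drop_at !expr1.
  by apply: le_trans (vc m) _; apply: le_trans Ww _; nra.
have := profileM IH pc.
have -> : (fun k => c k ^+ m.+1 * c k) = (fun k => c k ^+ m.+2).
  by apply/funext => k; rewrite -exprSr.
move=> [b d ms v]; split=> // [k|j].
  by apply: le_trans (ms k) _; rewrite -[m.+2%:R]natr1 mulrDl mul1r.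
have m0 : 0 <= m%:R :> R by [].
apply: le_trans (v j) _; rewrite -!natr1.
have : m%:R * w >= 0 by rewrite mulr_ge0.
by nra.
Qed.

(** A sequence sampled from a concave decreasing function that vanishes at n. *)
Definition concave_to n c :=
  [/\ forall k, 0 <= c k <= 1, forall k, (n <= k)%N -> c k = 0,
      forall k, c k.+1 <= c k &
      forall k, (k.+1 < n)%N -> drop_at c k <= drop_at c k.+1].

(** The drops increase up to the index n and vanish afterwards, so that the
    largest loss over h consecutive indices is the last one, c (n - h).  The
    differences of the drops at lag h are nonnegative before n - h, where they
    telescope, and the remaining drops telescope to c (n - h) again. *)
Lemma profile_concave h n c : concave_to n c ->
  profile h (c (n - h)%N) (2 * c (n - h)%N) c.
Proof.
move=> [bc c0 dc vc].
have hc : nonincreasing_seq c by apply/nonincreasing_seqP.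
have dhomo i j : (i <= j)%N -> (j < n)%N -> drop_at c i <= drop_at c j.
  move=> ij; rewrite -(subnK ij); elim: (j - i)%N => // l IH ln.
  by apply: le_trans (IH (ltnW ln)) _; exact: vc.
pose D k := c k - c (k + h)%N.
have DS k : (k + h < n)%N -> D k <= D k.+1.
  move=> khn; rewrite -subr_ge0.
  have -> : D k.+1 - D k = drop_at c (k + h)%N - drop_at c k.
    by rewrite /D /drop_at addSn; ring.
  by rewrite subr_ge0 dhomo// leq_addr.
have Dh k : (k <= n - h)%N -> D k <= D (n - h)%N.
  move=> kn; have : (k + (n - h - k) = n - h)%N by lia.
  move: (n - h - k)%N => l; elim: l k {kn} => [|l IH] k kE.
    by rewrite -kE addn0.
  by apply: le_trans (DS k _) (IH k.+1 _); lia.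
have Dc k : D k <= c k by rewrite gerBl; have /andP[] := bc (k + h)%N.
split=> // [k|m].
  have [kn|/ltnW nk] := leqP k (n - h); first exact: le_trans (Dh _ kn) (Dc _).
  by apply: le_trans (hc _ _ nk); exact: Dc.
(* G is a primitive of the summands, before and after the index n - h. *)
pose b := (n - h)%N.
pose G k := if (k <= b)%N then D k else D b + c b - c k.
rewrite (eq_bigr (fun k : 'I_m => G k.+1 - G k)); last first.
  move=> -[k /= _] _; rewrite /G; case: (ltnP k b) => kb.
    rewrite (ltnW kb) ger0_norm ?subr_ge0.
      by rewrite /D /drop_at addSn; ring.
    by apply: dhomo; move: kb; rewrite /b; lia.
  have -> : drop_at c (k + h)%N = 0.
    by rewrite /drop_at !c0 ?subrr//; move: kb; rewrite /b; lia.
  rewrite sub0r normrN ger0_norm ?subr_ge0 ?dc// /drop_at.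
  case: (leqP k b) => kb'; last by ring.
  by have -> : k = b; [lia|ring].
rewrite -(big_mkord xpredT (fun k => G k.+1 - G k)) telescope_sumr//.
have G0 : 0 <= G 0%N by rewrite /G/= /D subr_ge0 hc.
apply: (@le_trans _ _ (G m)); first by rewrite gerBl.
rewrite mulr_natl mulr2n /G -/b; case: leqP => mb.
  by apply: (le_trans (Dh _ mb)); rewrite (le_trans (Dc _))// lerDl;
    have /andP[] := bc b.
by rewrite -addrA lerD// gerBl; have /andP[] := bc m.
Qed.

End profiles.

(** * The coefficients of the Riesz means *)

Section riesz_profile.
Context {R : realType}.
Implicit Types (g b x y : R) (h n k m : nat).

Let one_powR b : 1 `^ b = 1 :> R. Proof. by rewrite powR1. Qed.

Lemma powR_midconvex b x y : 1 <= b -> 0 <= x -> 0 <= y ->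
  ((x + y) / 2) `^ b <= (x `^ b + y `^ b) / 2.
Proof.
move=> b1 x0 y0.
have half : 1 - 2^-1 = 2^-1 :> R by lra.
have h0 : 0 <= 2^-1 :> R by lra.
have h1 : 2^-1 <= 1 :> R by lra.
have := @convex_powR R b b1 (Itv01 h0 h1) x y.
rewrite !inE/= !in_itv/= !andbT => /(_ x0 y0).
rewrite [X in X `^ _ <= _ -> _]convRE [X in _ <= X -> _]convRE/= /unstable.onem half.
have -> : (x + y) / 2 = 2^-1 * x + 2^-1 * y by lra.
by lra.
Qed.

(** Midpoint convexity of the inverse function, the power 1 / b. *)
Lemma powR_midconcave b x y : 0 < b <= 1 -> 0 <= x -> 0 <= y ->
  (x `^ b + y `^ b) / 2 <= ((x + y) / 2) `^ b.
Proof.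
move=> /andP[b0 b1] x0 y0; have b1' : 1 <= b^-1 by rewrite invf_ge1.
have bb z : 0 <= z -> (z `^ b) `^ b^-1 = z.
  by move=> z0; rewrite -powRrM divff ?gt_eqF// powRr1.
have s0 : 0 <= (x `^ b + y `^ b) / 2 by rewrite divr_ge0// addr_ge0// powR_ge0.
have := powR_midconvex b1' (powR_ge0 x b) (powR_ge0 y b).
rewrite !bb// => /(ge0_ler_powR (ltW b0)).
rewrite !nnegrE powR_ge0 divr_ge0 ?addr_ge0// => /(_ isT isT).
by rewrite -powRrM mulVf ?gt_eqF// powRr1.
Qed.

Definition riesz_coef g b n k : R :=
  if (k < n)%N then (1 - (k%:R / n%:R) `^ g) `^ b else 0.

(** At k = n both sides vanish, b being positive. *)
Lemma riesz_coefE g b n k : 0 < g -> 0 < b -> (0 < n)%N -> (k <= n)%N ->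
  riesz_coef g b n k = (1 - (k%:R / n%:R) `^ g) `^ b.
Proof.
move=> g0 b0 n0; rewrite /riesz_coef leq_eqVlt => /predU1P[->|->//].
rewrite ltnn divff ?pnatr_eq0 -?lt0n// powR1 subrr powR0//.
by rewrite gt_eqF.
Qed.

Lemma ratio_powR_le1 g n k : 1 <= g -> (k <= n)%N -> (0 < n)%N ->
  (k%:R / n%:R) `^ g <= 1 :> R.
Proof.
move=> g1 kn n0; have k0 : (0:R) <= k%:R / n%:R by rewrite divr_ge0.
rewrite -[leRHS](one_powR g); apply: ge0_ler_powR; rewrite ?nnegrE//.
  by rewrite (le_trans _ g1).
by rewrite ler_pdivrMr ?ltr0n// mul1r ler_nat.
Qed.

(** An increasing concave function of a concave function is concave. *)
Lemma riesz_coef_concave g b n : 1 <= g -> 0 < b <= 1 -> (0 < n)%N ->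
  concave_to n (riesz_coef g b n).
Proof.
move=> g1 /andP[b0 b1] n0; have g0 : 0 <= g by rewrite (le_trans _ g1).
pose r k : R := 1 - (k%:R / n%:R) `^ g.
have r0 k : (k <= n)%N -> 0 <= r k.
  by move=> kn; rewrite subr_ge0 ratio_powR_le1.
have r1 k : r k <= 1 by rewrite gerBl powR_ge0.
have E k : (k <= n)%N -> riesz_coef g b n k = r k `^ b.
  by move=> kn; rewrite riesz_coefE// (lt_le_trans _ g1).
have rS k : r k.+1 <= r k.
  rewrite lerD2l lerN2 ge0_ler_powR ?nnegrE ?divr_ge0//.
  by rewrite ler_pM2r ?invr_gt0 ?ltr0n// ler_nat.
split.
- move=> k; rewrite /riesz_coef; case: ltnP => kn; last by rewrite lexx ler01.
  rewrite powR_ge0/= -[leRHS](one_powR b).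
  apply: ge0_ler_powR; rewrite ?nnegrE//; first exact: ltW.
    exact: r0 (ltnW kn).
- by move=> k nk; rewrite /riesz_coef ltnNge nk.
- move=> k; have [kn|nk] := ltnP k n; last first.
    by rewrite /riesz_coef !ltnNge nk (leqW nk) lexx.
  rewrite (E _ kn) (E _ (ltnW kn)).
  apply: ge0_ler_powR (rS k); rewrite ?nnegrE; [exact: ltW|exact: r0|].
  exact: r0 (ltnW kn).
move=> k kn; have kn1 := ltnW kn; have kn' := ltnW kn1.
rewrite /drop_at (E _ kn') (E _ kn1) (E _ kn).
have A : (r k + r k.+2) / 2 <= r k.+1.
  have := powR_midconvex g1 (divr_ge0 (ler0n R k) (ler0n R n))
                            (divr_ge0 (ler0n R k.+2) (ler0n R n)).
  rewrite -mulrDl (_ : (k%:R + k.+2%:R) / n%:R / 2 = k.+1%:R / n%:R); last first.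
    by rewrite -!natr1; field; rewrite pnatr_eq0 -lt0n.
  by rewrite /r; lra.
have b01 : 0 < b <= 1 by rewrite b0.
have B : ((r k + r k.+2) / 2) `^ b <= r k.+1 `^ b.
  apply: ge0_ler_powR A; rewrite ?nnegrE; [exact: ltW| |exact: r0].
  by apply: divr_ge0 => //; apply: addr_ge0; exact: r0.
move: (le_trans (powR_midconcave b01 (r0 _ kn') (r0 _ kn)) B).
move: (_ `^ b) (_ `^ b) (_ `^ b) => p q s {A B}.
rewrite ler_pdivrMr// mulr_natr mulr2n => pqs.
by rewrite lerBlDr addrAC lerBrDr.
Qed.

Lemma riesz_coefX g b n k m :
  riesz_coef g b n k ^+ m.+1 = riesz_coef g (b * m.+1%:R) n k.
Proof.
rewrite /riesz_coef; case: ltnP => _; last by rewrite expr0n.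
by rewrite powRrM powR_mulrn// powR_ge0.
Qed.

(** With y = h / n, the Bernoulli inequality gives (1 - y) ^ M >= 1 - M y for
    an integer M >= g. *)
Lemma riesz_coef_tail g b : 1 <= g -> 0 < b -> exists2 M : R, 0 <= M &
  forall n h, (0 < n)%N -> riesz_coef g b n (n - h) <= (M * (h%:R / n%:R)) `^ b.
Proof.
move=> g1 b0; pose M := (Num.truncn g).+1.
have gM : g <= M%:R by apply/ltW/truncnS_gt.
exists M%:R => // n h n0.
have n0' : 0 < n%:R :> R by rewrite ltr0n.
rewrite /riesz_coef; case: ltnP => [hn|_]; last exact: powR_ge0.
have [nh|{}hn] := leqP n h.
  have := nh; rewrite -subn_eq0 => /eqP ->.
  rewrite mul0r powR0 ?subr0 ?gt_eqF ?(lt_le_trans _ g1)// powR1.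
  rewrite -[leLHS](one_powR b) ge0_ler_powR ?nnegrE ?mulr_ge0 ?divr_ge0 ?(ltW b0)//.
  by apply: mulr_ege1; rewrite ?ler1n// ler_pdivlMr// mul1r ler_nat.
rewrite natrB ?(ltnW hn)// mulrBl divff ?gt_eqF//.
have y0 : (0 : R) <= h%:R / n%:R by rewrite divr_ge0.
have y1 : h%:R / n%:R < 1 :> R by rewrite ltr_pdivrMr// mul1r ltr_nat.
move: (h%:R / n%:R) y0 y1 => y y0 y1.
have bern j : 1 - j%:R * y <= (1 - y) ^+ j.
  elim: j => [|j IH]; first by rewrite mul0r subr0 expr0.
  rewrite exprSr -natr1 mulrDl mul1r; apply: le_trans (ler_wpM2r _ IH); last lra.
  have : 0 <= j%:R * y * y by rewrite !mulr_ge0.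
  by lra.
apply: ge0_ler_powR; rewrite ?(ltW b0) ?nnegrE ?mulr_ge0//.
  rewrite subr_ge0 -[leRHS](one_powR g); apply: ge0_ler_powR; rewrite ?nnegrE; lra.
rewrite lerBlDl -lerBlDr; apply: le_trans (bern M) _.
rewrite -powR_mulrn; last lra.
by apply: ger_powR gM; lra.
Qed.

(** For a > 1 the sequence is no longer concave, but it is a power with
    integral exponent of the sequence with exponent b = a / (m + 1) <= 1. *)
Lemma riesz_profile g (a : R) : 1 <= g -> 0 < a ->
  exists2 b : R, 0 < b & exists2 C : R, 0 <= C & forall n h, (0 < n)%N ->
    profile h (C * (h%:R / n%:R) `^ b) (C * (h%:R / n%:R) `^ b)
            (riesz_coef g a n).
Proof.
move=> g1 a0; pose m := Num.truncn a.
have am : a < m.+1%:R by exact: truncnS_gt.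
have m0 : 0 < m.+1%:R :> R by [].
pose b := a / m.+1%:R.
have b01 : 0 < b <= 1 by rewrite divr_gt0// ler_pdivrMr// mul1r ltW.
have /andP[b0 b1] := b01.
have [M M0 HM] := riesz_coef_tail g1 b0.
exists b => //; exists ((m%:R + 4) ^+ 2 * M `^ b).
  by rewrite mulr_ge0 ?powR_ge0// sqr_ge0.
move=> n h n0.
have := profileX m (profile_concave h (riesz_coef_concave g1 b01 n0)) (lexx _).
rewrite (_ : (fun k => _) = riesz_coef g a n); last first.
  apply/funext => k; rewrite riesz_coefX; congr riesz_coef.
  by rewrite /b divfK// gt_eqF.
move=> [bc dc wc Wc].
have w0 : 0 <= riesz_coef g b n (n - h).
  by rewrite /riesz_coef; case: ifP => // _; exact: powR_ge0.
have wM := HM n h n0; rewrite powRM ?divr_ge0// in wM.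
split=> // [k|j]; rewrite -mulrA.
  apply: le_trans (wc k) _; apply: ler_pM => //.
  by rewrite -natr1; have : 0 <= m%:R :> R by []; nra.
by apply: le_trans (Wc j) _; apply: ler_wpM2l => //; exact: sqr_ge0.
Qed.

End riesz_profile.

(** * Decay of the one-variable kernel *)

Section kernel.
Context {R : realType}.
Implicit Types (c : nat -> R) (n h k : nat) (u x : R).

(** The sum of c |k| e^(iku) over |k| <= n, in real form. *)
Definition cos_kernel c n u : R :=
  c 0%N + 2 * \sum_(k < n) c k.+1 * cos (k.+1%:R * u).

Lemma cos_kernelN c n u : cos_kernel c n (- u) = cos_kernel c n u.
Proof. by rewrite /cos_kernel; under eq_bigr do rewrite mulrN cosN. Qed.

Lemma cos_kernel_norm c n u : cos_kernel c n `|u| = cos_kernel c n u.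
Proof. by case: (ger0P u) => // _; exact: cos_kernelN. Qed.

Lemma cos_kernel_le c n u : (0 < n)%N -> (forall k, 0 <= c k <= 1) ->
  `|cos_kernel c n u| <= 3 * n%:R.
Proof.
move=> n0 bc; apply: le_trans (ler_normD _ _) _.
have c0 k : `|c k| <= 1 by have /andP[c0 c1] := bc k; rewrite ger0_norm.
have : `|\sum_(k < n) c k.+1 * cos (k.+1%:R * u)| <= n%:R.
  apply: le_trans (ler_norm_sum _ _ _) _.
  have -> : n%:R = \sum_(k < n) (1 : R) by rewrite sumr_const card_ord.
  apply: ler_sum => k _.
  by rewrite normrM mulr_ile1// cos_max.
have : 1 <= n%:R :> R by rewrite ler1n.
have := c0 0%N.
rewrite normrM (@ger0_norm _ 2)//; lra.
Qed.

(** Summation by parts against the Dirichlet kernels. *)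
Lemma cos_kernel_sin c n u :
  cos_kernel c n u * sin (u / 2) =
  \sum_(k < n) drop_at c k * sin ((k%:R + 2^-1) * u)
  + c n * sin ((n%:R + 2^-1) * u).
Proof.
rewrite /cos_kernel; elim: n => [|n IH].
  by rewrite !big_ord0 mulr0 addr0 add0r add0r (mulrC u).
rewrite !big_ord_recr/= mulrDr addrA mulrDl IH.
have -> : (n%:R + 2^-1) * u = n.+1%:R * u - u / 2 by rewrite -natr1; field.
have -> : (n.+1%:R + 2^-1) * u = n.+1%:R * u + u / 2 by field.
by rewrite /drop_at sinB sinD; ring.
Qed.

(** Multiplying sin ((k + 1/2) u) by 2 sin (h u / 2) gives a difference of two
    cosines whose arguments are h indices apart.  Moving this lag onto the
    coefficients leaves the first h drops, whose sum is at most w, and the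
    differences of the drops at lag h. *)
Lemma cos_kernel_lag c n h w W u :
  profile h w W c -> (forall k, (n <= k)%N -> c k = 0) ->
  `|cos_kernel c n u| * `|sin (u / 2)| * `|2 * sin (h%:R * u / 2)| <= w + W.
Proof.
move=> [bc dc wc Wc] c0.
rewrite -normrM cos_kernel_sin c0// mul0r addr0 -normrM.
pose C k := cos ((k%:R + 2^-1) * u - h%:R * u / 2).
have E : (\sum_(k < n) drop_at c k * sin ((k%:R + 2^-1) * u))
      * (2 * sin (h%:R * u / 2)) =
    \sum_(k < h) drop_at c k * C k
    + \sum_(k < n) (drop_at c (k + h)%N - drop_at c k) * C (k + h)%N.
  have S : \sum_(k < h) drop_at c k * C k
      + \sum_(k < n) drop_at c (k + h)%N * C (k + h)%N
      = \sum_(k < n) drop_at c k * C k.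
    pose F k := drop_at c k * C k.
    have F0 : \sum_(n <= k < n + h) F k = 0.
      rewrite big_nat_cond big1// => k; rewrite andbT => /andP[nk _].
      by rewrite /F /drop_at !c0 ?subrr ?mul0r ?(leqW nk).
    rewrite -[RHS]addr0 -[X in _ = _ + X]F0.
    rewrite -!(big_mkord xpredT F) -(big_mkord xpredT (fun k => F (k + h)%N)).
    rewrite -(@big_cat_nat _ _ _ n 0 (n + h)) ?leq_addr//=.
    rewrite [RHS](@big_cat_nat _ _ _ h 0 (n + h)) ?leq_addl//=.
    have -> // : \sum_(h <= k < n + h) F k = \sum_(0 <= k < n) F (k + h)%N.
    by rewrite -{1}[h]add0n big_addn addnK.
  rewrite mulr_suml.
  under [X in _ = _ + X]eq_bigr do rewrite mulrBl.
  rewrite sumrB addrA S -sumrB; apply: eq_bigr => k _.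
  rewrite /C natrD.
  have -> : (k%:R + h%:R + 2^-1) * u - h%:R * u / 2
          = (k%:R + 2^-1) * u + h%:R * u / 2 by field.
  by rewrite cosB cosD; ring.
rewrite E; apply: le_trans (ler_normD _ _) _; apply: lerD.
  apply: le_trans (ler_norm_sum _ _ _) _.
  apply: le_trans (wc 0%N); rewrite add0n -sum_drop_at; apply: ler_sum => k _.
  have d0 : 0 <= drop_at c k by rewrite subr_ge0.
  by rewrite normrM (ger0_norm d0) ler_piMr// cos_max.
apply: le_trans (ler_norm_sum _ _ _) _.
apply: le_trans (Wc n); apply: ler_sum => k _.
by rewrite normrM ler_piMr// cos_max.
Qed.

(** The mean value theorem on [0, 1], monotonicity beyond. *)
Lemma sin_ge_linear x : 0 <= x <= pi / 2 -> cos 1 / 2 * x <= sin x.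
Proof.
move=> /andP[x0 xpi].
have c1 : 0 < cos 1 :> R := cos1_gt0 R.
have p1 : 1 <= pi / 2 :> R := pihalf_ge1 R.
have p2 : pi / 2 < 2 :> R := pihalf_lt2 R.
have small (y : R) : 0 < y <= 1 -> cos 1 * y <= sin y.
  move=> /andP[y0 y1].
  have [z] := @MVT R sin cos 0 y y0 (fun z _ => is_derive_sin z)
    (continuous_subspaceT (@continuous_sin R)).
  rewrite in_itv/= => /andP[z0 zy]; rewrite sin0 !subr0 => ->.
  rewrite ler_wpM2r ?(ltW y0)// ltW// ltr_cos ?in_itv/=; lra.
have [xle1|x1] := leP x 1.
  have [->|xn0] := eqVneq x 0; first by rewrite mulr0 sin0.
  have : cos 1 * x <= sin x by apply: small; rewrite lt_neqAle eq_sym xn0 x0.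
  by apply: le_trans; nra.
have s1 : cos 1 <= sin 1 :> R by rewrite -[leLHS]mulr1 small// ltr01 lexx.
apply: (@le_trans _ _ (cos 1)); first nra.
apply: le_trans s1 _; apply: ltW; rewrite ltr_sin ?in_itv/=; lra.
Qed.

(** The choice h = floor (pi / (2 u)) + 1 puts h u in ]pi/2, 3 pi/2], away from
    the zeros of sin (h u / 2), while h stays comparable to 1 / u. *)
Lemma lag_sin u : 0 < u <= pi -> exists h, h%:R * u <= 6 /\
  cos 1 / 4 <= sin (h%:R * u / 2).
Proof.
move=> /andP[u0 upi].
have c1 : 0 < cos 1 :> R := cos1_gt0 R.
have p1 : 1 <= pi / 2 :> R := pihalf_ge1 R.
have p2 : pi / 2 < 2 :> R := pihalf_lt2 R.
pose t := pi / 2 / u; have t0 : 0 <= t by rewrite !divr_ge0 ?pi_ge0// ltW.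
have tu : t * u = pi / 2 by rewrite /t divfK// gt_eqF.
exists (Num.truncn t).+1.
have /andP[h1 h2] := truncn_itv t0.
have hu1 : pi / 2 <= (Num.truncn t).+1%:R * u.
  by rewrite -tu ler_pM2r// ltW.
have hu2 : (Num.truncn t).+1%:R * u <= pi / 2 + u.
  by rewrite -tu -natr1 mulrDl mul1r lerD2r ler_pM2r.
move: ((Num.truncn t).+1%:R * u) hu1 hu2 => y hu1 hu2.
split; first lra.
have [yp|yp] := leP (y / 2) (pi / 2).
  apply: le_trans (sin_ge_linear _); last lra.
  nra.
(* Beyond pi / 2 the sine is read at pi - y / 2. *)
rewrite -[sin _]opprK -sinN -[- (y / 2)](addrK pi).
have -> : - (y / 2) + pi - pi = (pi - y / 2) - pi by ring.
rewrite sinB sinpi cospi mulr0 subr0 mulrN1 opprK.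
apply: le_trans (sin_ge_linear _); last lra.
nra.
Qed.


(** The lag estimate with h of the order of 1 / |u|: the coefficients bring
    (h / n) ^ b, and sin (u / 2) brings the factor |u|. *)
Lemma riesz_kernel_decay (g a : R) : 1 <= g -> 0 < a ->
  exists2 b : R, 0 < b & exists2 C : R, 0 <= C &
  forall n u, (0 < n)%N -> `|u| <= pi ->
    `|cos_kernel (riesz_coef g a n) n u| * `|u| * (n%:R * `|u|) `^ b <= C.
Proof.
move=> g1 a0; have [b b0 [C C0 HC]] := riesz_profile g1 a0.
exists b => //; pose s := cos 1 : R; have s0 : 0 < s := cos1_gt0 R.
exists (2 * (C * 6 `^ b) / (s / 4 * (s / 2))).
  by rewrite divr_ge0// ?mulr_ge0 ?powR_ge0// ltW.
move=> n u n0 upi; rewrite -cos_kernel_norm.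
have := normr_ge0 u; rewrite le_eqVlt => /predU1P[<-|u0].
  by rewrite mulr0 mul0r divr_ge0// ?mulr_ge0 ?powR_ge0// ltW.
move: (`|u|) u0 upi => v v0 vpi {u}.
have v0pi : 0 < v <= pi by rewrite v0.
have [h [hv hs]] := lag_sin v0pi.
have n0R : 0 < n%:R :> R by rewrite ltr0n.
have z k : (n <= k)%N -> riesz_coef g a n k = 0.
  by rewrite /riesz_coef ltnNge => ->.
have := cos_kernel_lag v (HC n h n0) z.
rewrite [leRHS](_ : _ = 2 * (C * (h%:R / n%:R) `^ b)); last by ring.
set K := `|cos_kernel _ _ _|; set w := _ `^ b => HK.
have K0 : 0 <= K by rewrite normr_ge0.
have wv : w * (n%:R * v) `^ b <= 6 `^ b.
  rewrite /w -powRM ?divr_ge0 ?mulr_ge0 ?(ltW v0)//.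
  rewrite mulrA divfK ?gt_eqF//.
  by apply: ge0_ler_powR hv; rewrite ?nnegrE ?mulr_ge0 ?(ltW v0) ?(ltW b0).
have sv : s / 4 * v <= `|sin (v / 2)|.
  apply: le_trans (ler_norm _); apply: le_trans (sin_ge_linear _).
    by rewrite -/s; lra.
  by apply/andP; split; lra.
have sh : s / 2 <= `|2 * sin (h%:R * v / 2)|.
  by apply: le_trans (ler_norm _); rewrite -/s in hs; lra.
rewrite ler_pdivlMr ?mulr_gt0 ?divr_gt0//.
apply: (@le_trans _ _ (2 * (C * w) * (n%:R * v) `^ b)); last first.
  by rewrite -!mulrA ler_wpM2l// ler_wpM2l.
have -> : K * v * (n%:R * v) `^ b * (s / 4 * (s / 2))
  = (K * (s / 4 * v) * (s / 2)) * (n%:R * v) `^ b by ring.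
rewrite ler_wpM2r ?powR_ge0//; apply: le_trans HK.
apply: ler_pM => //; first by rewrite !mulr_ge0 ?divr_ge0// ltW.
  by rewrite divr_ge0// ltW.
by rewrite ler_wpM2l.
Qed.

(** The decay at |u| of the order of 2 ^ (j - l), for an n of the order of
    2 ^ l.  The number r is 2 ^ (b / 2), so that 2 r ^ 2 = 2 ^ (1 + b) carries
    both the factor |u| and the factor (n |u|) ^ b. *)
Lemma riesz_kernel_dyadic (g a t : R) : 1 <= g -> 0 < a -> 1 <= t ->
  exists2 r : R, 1 < r & exists2 C : R, 0 < C & forall l n u, (0 < n)%N ->
    2 ^+ l <= t * n%:R -> n%:R <= 2 * t * 2 ^+ l -> `|u| <= pi ->
    exists2 j, (j < l.+3)%N & 2 ^+ l * `|u| <= 2 ^+ j /\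
    `|cos_kernel (riesz_coef g a n) n u| * (2 * r ^+ 2) ^+ j <= C * 2 ^+ l.
Proof.
move=> g1 a0 t1; have [b b0 [C C0 HC]] := riesz_kernel_decay g1 a0.
have [b' _ [C' _ HP]] := riesz_profile g1 a0.
have t0 : 0 < t by exact: lt_le_trans t1.
pose r : R := 2 `^ (b / 2); have r1 : 1 < r.
  rewrite /r -[ltLHS](powRr0 2) /powR pnatr_eq0/= ltr_expR mul0r mulr_gt0//.
    by rewrite divr_gt0.
  by rewrite ln_gt0// ltr1n.
have Q : 2 * r ^+ 2 = 2 `^ (1 + b).
  rewrite powRD ?pnatr_eq0 ?implybT// powRr1// -powR_mulrn ?powR_ge0//.
  by rewrite /r -powRrM divfK.
exists r => //; exists (6 * t + C * t `^ b * (2 * r ^+ 2)).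
  rewrite ltr_wpDr// ?mulr_gt0// !mulr_ge0 ?powR_ge0//.
move=> l n u n0 nt nt' upi.
have l0 : 0 < 2 ^+ l :> R by rewrite exprn_gt0.
pose K : R := `|cos_kernel (riesz_coef g a n) n u|; pose v : R := 2 ^+ l * `|u|.
have K0 : 0 <= K by rewrite normr_ge0.
have pi4 : pi < 4 :> R by have := pihalf_lt2 R; lra.
have vl : v <= 2 ^+ l.+2.
  by rewrite /v !exprS; have := normr_ge0 u; nra.
(* The least j with 2 ^ l |u| <= 2 ^ j; for j > 0 it is sharp up to 2. *)
have ex : exists j, (v <= 2 ^+ j) by exists l.+2.
case: (ex_minnP ex) => j vj jmin; exists j; first by rewrite ltnS jmin.
split=> //; case: j vj jmin => [|j] vj jmin.
  rewrite expr0 mulr1.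
  have [bc _ _ _] := HP n 0%N n0.
  apply: le_trans (cos_kernel_le _ n0 bc) _.
  rewrite [leRHS]mulrDl; apply: ler_wpDr.
    by rewrite !mulr_ge0 ?powR_ge0// ?sqr_ge0// ltW.
  apply: (@le_trans _ _ (3 * (2 * t * 2 ^+ l))); first by rewrite ler_wpM2l.
  by rewrite [leLHS](_ : _ = 6 * t * 2 ^+ l)//; ring.
have jv : 2 ^+ j <= v by rewrite leNgt; apply/negP => /ltW/jmin; rewrite ltnn.
have v0 : 0 <= v by rewrite mulr_ge0// ltW.
have Qj : (2 * r ^+ 2) ^+ j <= v * v `^ b.
  rewrite Q -[_ ^+ j]powR_mulrn ?powR_ge0// powRAC powR_mulrn//.
  have <- : v `^ (1 + b) = v * v `^ b.
    rewrite powRD ?powRr1//; apply/implyP => /eqP E.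
    by move: b0; lra.
  apply: ge0_ler_powR jv; rewrite ?nnegrE ?exprn_ge0//.
  by rewrite addr_ge0// ltW.
have vb : v `^ b <= t `^ b * (n%:R * `|u|) `^ b.
  rewrite -powRM ?mulr_ge0 ?(ltW t0)//.
  apply: ge0_ler_powR; rewrite ?nnegrE ?mulr_ge0 ?(ltW t0) ?(ltW b0)//.
  by rewrite mulrA ler_wpM2r.
have Q0 : 0 <= 2 * r ^+ 2 by rewrite mulr_ge0// sqr_ge0.
have KQ : K * (2 * r ^+ 2) ^+ j <= C * t `^ b * 2 ^+ l.
  apply: (@le_trans _ _ (K * (v * (t `^ b * (n%:R * `|u|) `^ b)))).
    rewrite ler_wpM2l//; apply: le_trans Qj _; exact: ler_wpM2l.
  have -> : K * (v * (t `^ b * (n%:R * `|u|) `^ b))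
    = K * `|u| * (n%:R * `|u|) `^ b * (t `^ b * 2 ^+ l) by rewrite /v; ring.
  rewrite -[leRHS]mulrA ler_wpM2r ?HC// mulr_ge0 ?powR_ge0//; exact: ltW.
rewrite -/K; move: (2 * r ^+ 2) Q0 KQ => q Q0 KQ.
rewrite exprSr mulrA; apply: le_trans (ler_wpM2r Q0 KQ) _.
rewrite [leRHS](_ : _ = C * t `^ b * 2 ^+ l * q + 6 * t * 2 ^+ l);
  last by ring.
by rewrite ler_wpDr// !mulr_ge0// ltW.
Qed.

End kernel.

(** * Weak-type covering by nested dyadic grids *)

Section covering.
Context {R : realType}.

Lemma floor_coarse (y s : R) (m : nat) : 0 < s -> (0 < m)%N ->
  Num.floor (y / (s * m%:R)) = Num.floor ((Num.floor (y / s))%:~R / m%:R : R).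
Proof.
move=> s0 m0; have m0' : 0 < m%:R :> R by rewrite ltr0n.
rewrite invfM mulrA; move: (y / s) => z {y}.
have /andP[h1 h2] := floor_itv ((Num.floor z)%:~R / m%:R : R).
set K := Num.floor (_ / _) in h1 h2 *.
apply: floor_def; apply/andP; split.
  by apply: le_trans h1 _; rewrite ler_pM2r ?invr_gt0// floor_le.
rewrite ltr_pdivrMr// in h2; rewrite ltr_pdivrMr//.
rewrite [m%:R](_ : _ = m%:Z%:~R)// -intrM in h2 *.
by rewrite ltr_int in h2; rewrite -floor_lt_int.
Qed.

Lemma floor_near (y t s : R) : 0 < s -> `|y - t| <= s ->
  exists e : 'I_3, Num.floor (t / s) = Num.floor (y / s) + (e%:Z - 1).
Proof.
move=> s0 yt; have /andP[a1 a2] := floor_itv (t / s).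
have /andP[b1 b2] := floor_itv (y / s).
have yts : `|y / s - t / s| <= 1.
  by rewrite -mulrBl normrM normfV (gtr0_norm s0) ler_pdivrMr// mul1r.
move: (Num.floor (t / s)) (Num.floor (y / s)) a1 a2 b1 b2 => a b.
rewrite ler_norml in yts; move: (y / s) (t / s) yts {yt} => {}y {}t yts a1 a2 b1 b2.
have h1 : a < b + 2.
  by rewrite -(ltr_int R) intrD; move: a2 b2; rewrite !intrD; lra.
have h2 : b < a + 2.
  by rewrite -(ltr_int R) intrD; move: a2 b2; rewrite !intrD; lra.
have hn : (absz (a - b + 1)%R < 3)%N by lia.
by exists (Ordinal hn) => /=; lia.
Qed.

Lemma measurable_tuple_box d (B : 'I_d -> set R) :
  (forall i, measurable (B i)) ->
  measurable [set t : d.-tuple R | forall i, B i (tnth t i)].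
Proof.
move=> mB; rewrite (_ : [set t | _] = \bigcap_(i : 'I_d)
    ((fun t : d.-tuple R => tnth t i) @^-1` B i)).
  apply: fin_bigcap_measurable => // i _; rewrite -[X in measurable X]setTI.
  exact: measurable_tnth.
by apply/seteqP; split=> t /= tA i; [move=> _|]; exact: tA.
Qed.

Lemma measurable_torus d : measurable (@torus R d).
Proof.
rewrite (_ : torus = [set t : d.-tuple R | forall i,
  [set` `[(- pi : R), pi]] (tnth t i)]).
  exact: (@measurable_tuple_box _ (fun=> [set` `[(- pi : R), pi]])).
by apply/seteqP; split=> t /= h i; have := h i; rewrite in_itv.
Qed.

Variables (d : nat) (F : d.-tuple R -> R) (j : 'I_d -> nat) (c : 'I_d -> R).
Hypotheses (F0 : forall t, 0 <= F t) (mF : measurable_fun torus F).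

Local Notation mu := (@lebesgue_tuple R d).
Local Notation index := {ffun 'I_d -> int}.
Implicit Types (l L : nat) (k : index) (i : 'I_d) (t x : d.-tuple R) (w : R).

Definition mass (A : set (d.-tuple R)) : \bar R :=
  (\int[mu]_(t in torus `&` A) (F t)%:E)%E.

(** The exponents j are fixed, so that the sides of all cells of level l shrink
    together with l: the cells form a one-parameter family of nested grids,
    whatever the shape of the cells. *)
Definition side l i : R := 2 ^+ j i / 2 ^+ l.

Definition cell l k : set (d.-tuple R) :=
  [set t | forall i, Num.floor (tnth t i / side l i) = k i].

Definition dilated_itv l k i : set R :=
  [set` `[(k i - 1)%:~R * side l i + c i, (k i + 2)%:~R * side l i + c i[].

(** The cell together with its neighbours, translated by c. *)
Definition dilated_cell l k : set (d.-tuple R) :=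
  [set x | forall i, dilated_itv l k i (tnth x i)].

(** The number w is the threshold for the average of F over a cell. *)
Definition heavy w l k := ((w * \prod_i side l i)%:E < mass (cell l k))%E.

Lemma side_gt0 l i : 0 < side l i.
Proof. by rewrite divr_gt0// exprn_gt0. Qed.

Lemma side_coarse l l' i : (l' <= l)%N ->
  side l' i = side l i * (2 ^ (l - l'))%:R.
Proof.
move=> ll; rewrite /side natrX -{1}(subnK ll) exprD.
have : 2 ^+ (l - l') != 0 :> R by rewrite expf_neq0.
have : 2 ^+ l' != 0 :> R by rewrite expf_neq0.
by move=> h1 h2; field; apply/andP.
Qed.

(** For an integer m the floor of z / m depends only on the floor of z, which
    makes the grids nested. *)
Lemma cell_coarse l l' k t : (l' <= l)%N -> cell l k t ->
  cell l' [ffun i => Num.floor ((k i)%:~R / (2 ^ (l - l'))%:R : R)] t.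
Proof.
move=> ll tk i; rewrite ffunE (side_coarse i ll) floor_coarse ?side_gt0//.
  by rewrite tk.
by rewrite expn_gt0.
Qed.

Lemma cell_inj l k k' t : cell l k t -> cell l k' t -> k = k'.
Proof. by move=> h h'; apply/ffunP => i; rewrite -h h'. Qed.

Lemma cell_nested l l' k k' t : (l' <= l)%N -> cell l k t -> cell l' k' t ->
  cell l k `<=` cell l' k'.
Proof.
move=> ll tk tk' x /(cell_coarse ll).
by have := cell_inj (cell_coarse ll tk) tk' => ->.
Qed.

Lemma dilated_nested l l' k k' t : (l' <= l)%N -> cell l k t -> cell l' k' t ->
  dilated_cell l k `<=` dilated_cell l' k'.
Proof.
move=> ll tk tk' x xk i.
have <- := cell_inj (cell_coarse ll tk) tk'; rewrite /dilated_itv ffunE.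
have := xk i; rewrite /dilated_itv/= !in_itv/=.
have m1 : 1 <= (2 ^ (l - l'))%:R :> R by rewrite ler1n expn_gt0.
rewrite (side_coarse i ll); have s0 := side_gt0 l i.
move: (side l i) s0 => s s0; move: (2 ^ (l - l'))%N m1 => m m1.
have m0 : 0 < m%:R :> R by exact: lt_le_trans m1.
have /andP[h1 h2] := floor_itv ((k i)%:~R / m%:R : R).
set K := Num.floor _ in h1 h2 *.
rewrite ler_pdivlMr// in h1; rewrite ltr_pdivrMr// in h2.
have h3 : (k i + 1)%:~R <= (K + 1)%:~R * m%:R :> R.
  rewrite [m%:R](_ : _ = m%:Z%:~R)// -intrM in h2 *.
  by rewrite ltr_int in h2; rewrite ler_int lezD1.
move: (k i) K h1 h2 h3 => a b h1 h2 h3.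
rewrite !intrD in h1 h2 h3 *; move=> /andP[u1 u2]; apply/andP; split; nra.
Qed.

Lemma measurable_cell l k : measurable (cell l k).
Proof.
rewrite (_ : cell l k = [set t : d.-tuple R | forall i,
  [set` `[(k i)%:~R * side l i, (k i + 1)%:~R * side l i[] (tnth t i)]).
  by apply: (measurable_tuple_box (B := fun i => [set` `[(k i)%:~R * side l i,
    (k i + 1)%:~R * side l i[])) => i; exact: measurable_itv.
have E t i : Num.floor (tnth t i / side l i) = k i <->
    (k i)%:~R * side l i <= tnth t i < (k i + 1)%:~R * side l i.
  rewrite -ler_pdivlMr ?side_gt0// -ltr_pdivrMr ?side_gt0// -floor_eq.
  by split=> [->|/eqP].
by apply/seteqP; split=> t /= h i; have := h i; rewrite in_itv/= E.
Qed.

Lemma measurable_dilated l k : measurable (dilated_cell l k).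
Proof. by apply: measurable_tuple_box => i; exact: measurable_itv. Qed.

Lemma dilated_measure l k :
  mu (dilated_cell l k) = (3 ^+ d * \prod_i side l i)%:E.
Proof.
rewrite (lebesgue_tuple_box (A := dilated_itv l k)); last first.
  by move=> i; exact: measurable_itv.
rewrite (eq_bigr (fun i => (3 * side l i)%:E)) => [|i _].
  rewrite prodEFin big_split/= prodr_const card_ord//.
rewrite lebesgue_measure_itv/= lte_fin ifT.
  by rewrite -EFinB !intrD; congr EFin; ring.
by rewrite ltrD2r ltr_pM2r ?side_gt0// ltr_int; lia.
Qed.

(** The heavy cells that are maximal for inclusion; level 0 carries the largest
    cells, so that every heavy cell lies in a maximal one. *)
Definition top_heavy w l k := heavy w l k /\
  forall l' k', (l' < l)%N -> cell l k `<=` cell l' k' -> ~ heavy w l' k'.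

(** A cell that does not meet the torus has no mass. *)
Lemma heavy_torus w l k : 0 < w -> heavy w l k ->
  exists2 t, torus t & cell l k t.
Proof.
move=> w0; apply: contraPP => /forall2NP h; rewrite /heavy /mass.
rewrite (_ : torus `&` _ = set0) ?integral_set0.
  apply/negP; rewrite -leNgt lee_fin mulr_ge0 ?(ltW w0)// prodr_ge0// => i _.
  exact/ltW/side_gt0.
by apply/seteqP; split=> t //= -[tt tk]; case: (h t).
Qed.

Lemma top_heavy_cover w l k : 0 < w -> heavy w l k ->
  exists l' k', [/\ (l' <= l)%N, top_heavy w l' k' &
    dilated_cell l k `<=` dilated_cell l' k'].
Proof.
move=> w0; elim/ltn_ind: l k => l IH k hk.
have [tk|] := pselect (top_heavy w l k); first by exists l, k; split.
move=> /not_andP[//|] /existsNP[l'] /existsNP[k'] /not_implyP[ll].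
move=> /not_implyP[sub] /contrapT hk'.
have [t _ tk] := heavy_torus w0 hk.
have [l2 [k2 [ll2 h2 sub2]]] := IH _ ll _ hk'.
exists l2, k2; split=> //; first exact: leq_trans ll2 (ltnW ll).
apply: subset_trans sub2; exact: dilated_nested (ltnW ll) tk (sub _ tk).
Qed.

Definition tops w L : set (nat * index) :=
  [set q | (q.1 < L)%N /\ top_heavy w q.1 q.2].

(** Two cells that meet are nested, and a heavy cell inside another heavy cell
    is not maximal. *)
Lemma trivIset_tops w L : trivIset (tops w L) (fun q => cell q.1 q.2).
Proof.
move=> [l k] [l' k'] [_ [hk top]] [_ [hk' top']] [t [/= tk tk']].
wlog ll : l k l' k' hk top hk' top' tk tk' / (l' <= l)%N.
  by case/orP: (leq_total l l') => ll wl; [symmetry|]; exact: wl.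
move: ll; rewrite leq_eqVlt => /predU1P[ll|ll].
  by subst l'; rewrite (cell_inj tk tk').
by case: (top _ k' ll) => //; exact: cell_nested (ltnW ll) tk tk'.
Qed.

(** The cells of level l < L have sides at least 2 ^ - L, and the maximal heavy
    ones meet the torus, which bounds their indices. *)
Lemma finite_tops w L : 0 < w -> finite_set (tops w L).
Proof.
move=> w0; pose B := (4 * 2 ^ L + 1)%N.
pose f (q : 'I_L * {ffun 'I_d -> 'I_(B + B).+1}) : nat * index :=
  (nat_of_ord q.1, [ffun i => (nat_of_ord (q.2 i))%:Z - B%:Z]).
apply: (@sub_finite_set _ _ (f @` setT)); last first.
  by apply: finite_image; exact: finite_finset.
move=> [l k] [/= lL [hk _]]; have [t tt tk] := heavy_torus w0 hk.
have kB i : (absz (k i) <= B)%N.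
  have s0 := side_gt0 l i; have := tk i; move: (tt i).
  have pi4 : pi < 4 :> R by have := pihalf_lt2 R; lra.
  have sL : 1 <= side l i * 2 ^+ L.
    rewrite /side mulrAC ler_pdivlMr ?exprn_gt0// mul1r.
    apply: (@le_trans _ _ (2 ^+ L)); first by rewrite ler_weXn2l// ?ler1n// ltnW.
    by rewrite ler_peMl ?exprn_ege1// ?ler1n// exprn_ge0.
  have /andP[h1 h2] := floor_itv (tnth t i / side l i).
  move=> /andP[t1 t2] E; rewrite E in h1 h2.
  have L0 : 0 <= 2 ^+ L :> R by rewrite exprn_ge0.
  rewrite ler_pdivlMr// in h1; rewrite ltr_pdivrMr// in h2.
  have BR : B%:~R = 4 * 2 ^+ L + 1 :> R by rewrite /B -pmulrn natrD natrM natrX.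
  have k1 : (k i)%:~R <= B%:~R :> R.
    rewrite BR leNgt; apply/negP => Bk; nra.
  have k2 : - B%:~R <= (k i)%:~R :> R.
    rewrite BR leNgt intrD in h2 *; apply/negP => Bk; nra.
  by rewrite -mulrNz !ler_int in k1 k2; lia.
have kB' i : (absz (k i + B%:Z)%R < (B + B).+1)%N.
  by have := kB i; lia.
exists (Ordinal lL, [ffun i => Ordinal (kB' i)]) => //; rewrite /f/=; congr pair.
apply/ffunP => i; rewrite !ffunE/=; have := kB i; lia.
Qed.

Lemma mass_tops w L : 0 < w ->
  (\sum_(q \in tops w L) mass (cell q.1 q.2) <= mass setT)%E.
Proof.
move=> w0; rewrite fsbig_finite/=; last exact: finite_tops.
have mT := @measurable_torus d.
have mC (q : nat * index) : measurable (torus `&` cell q.1 q.2).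
  by apply: measurableI => //; exact: measurable_cell.
have mU : measurable (\big[setU/set0]_(q <- finmap.enum_fset (fset_set (tops w L)))
    (torus `&` cell q.1 q.2)) by exact: bigsetU_measurable.
have sub : \big[setU/set0]_(q <- finmap.enum_fset (fset_set (tops w L)))
    (torus `&` cell q.1 q.2) `<=` torus.
  by move=> t; rewrite -bigcup_seq => -[q _ []].
rewrite /mass -(@ge0_integral_bigsetU _ _ _ _ _
  (fun q => torus `&` cell q.1 q.2))//.
- rewrite setIT; apply: ge0_subset_integral => //; last first.
    by move=> t _; rewrite lee_fin.
  exact/measurable_EFinP.
- exact: finmap.fset_uniq.
- apply: trivIset_setIl; apply: sub_trivIset (@trivIset_tops w L) => q /=.
  by rewrite in_fset_set ?inE//; exact: finite_tops.
- by apply: measurable_funS sub _ => //; exact/measurable_EFinP.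
- by move=> t _; rewrite lee_fin.
Qed.

(** The weak-type (1,1) estimate for averages over the cells: the set Y is the
    union of the dilates of the maximal heavy cells, which are disjoint.  The
    constant depends neither on the exponents j nor on the number L of levels. *)
Lemma cover_heavy w L : 0 < w -> exists Y,
  [/\ measurable Y,
      forall l k x, (l < L)%N -> heavy w l k -> dilated_cell l k x -> Y x &
      (mu Y <= (3 ^+ d / w)%:E * mass setT)%E].
Proof.
move=> w0; have fT := finite_tops L w0.
exists (\bigcup_(q in tops w L) dilated_cell q.1 q.2).
have mD : forall q, tops w L q -> measurable (dilated_cell q.1 q.2).
  by move=> q _; exact: measurable_dilated.
split; first exact: fin_bigcup_measurable.
  move=> l k x lL hk xk; have [l' [k' [ll' tk' sub]]] := top_heavy_cover w0 hk.
  exists (l', k'); last exact: sub.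
  by split=> //; exact: leq_ltn_trans lL.
apply: (@le_trans _ _ (\sum_(q \in tops w L) mu (dilated_cell q.1 q.2))%E).
  by apply: content_sub_fsum => //; exact: fin_bigcup_measurable.
apply: (@le_trans _ _ (\sum_(q \in tops w L)
    ((3 ^+ d / w)%:E * mass (cell q.1 q.2)))%E).
  apply: lee_fsum => // -[l k] [_ [/= hk _]].
  rewrite dilated_measure.
  (* Heaviness bounds the volume of a cell by its mass. *)
  have -> : 3 ^+ d * \prod_i side l i = 3 ^+ d / w * (w * \prod_i side l i).
    by field; rewrite gt_eqF.
  rewrite EFinM lee_pmul2l//; first exact: ltW.
  by rewrite lte_fin divr_gt0// exprn_gt0.
rewrite -ge0_mule_fsumr; last first.
  by move=> q; apply: integral_ge0 => t _; rewrite lee_fin.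
rewrite lee_wpmul2l ?mass_tops// lee_fin divr_ge0 ?exprn_ge0// ltW//.
Qed.

End covering.

(** * From the kernel to the cells *)

Section kernel_cells.
Context {R : realType}.
Implicit Types (u x t s : R) (l n : nat).

(** The three elements of 'I_3 stand for -1, 0 and 1. *)
Definition unit_offset (e : 'I_3) : int := e%:Z - 1.
Definition period_shift (e : 'I_3) : R := 2 * pi * (unit_offset e)%:~R.

Lemma cos_kernel_period (c : nat -> R) n u (e : 'I_3) :
  cos_kernel c n (u - period_shift e) = cos_kernel c n u.
Proof.
rewrite /cos_kernel; congr (_ + _ * _); apply: eq_bigr => k _; congr (_ * _).
case: e => -[|[|[|//]]] /= e3; rewrite /period_shift /unit_offset/=.
- rewrite -[RHS](periodicn (@cosD2pi R) k.+1); congr cos.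
  by rewrite -[(pi *+ 2) *+ _]mulr_natl -[pi *+ 2]mulr_natl; ring.
- by rewrite subrr mulr0 subr0.
- rewrite -[LHS](periodicn (@cosD2pi R) k.+1); congr cos.
  by rewrite -[(pi *+ 2) *+ _]mulr_natl -[pi *+ 2]mulr_natl; ring.
Qed.

(** The difference of two points of [-pi, pi] may be close to 2 pi or to
    -2 pi, where the kernel is as large as near 0. *)
Lemma torus_shift x t : - pi <= x <= pi -> - pi <= t <= pi ->
  exists e : 'I_3, `|x - t - period_shift e| <= pi.
Proof.
move=> /andP[x1 x2] /andP[t1 t2]; have p0 := pi_gt0 R.
have [h|h] := leP (x - t) pi; last first.
  exists (Ordinal (isT : 2 < 3)%N).
  rewrite /period_shift /unit_offset /= (_ : 2%:Z - 1 = 1)// mulr1 ler_norml; lra.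
have [h'|h'] := leP (- pi) (x - t).
  exists (Ordinal (isT : 1 < 3)%N).
  rewrite /period_shift /unit_offset /= subrr mulr0 subr0 ler_norml; lra.
exists (Ordinal (isT : 0 < 3)%N).
rewrite /period_shift /unit_offset /= sub0r mulrN1z mulrN1 opprK ler_norml; lra.
Qed.

(** For one coordinate: the exponent of the side of the cell, the period by
    which x is moved, and the position of the cell of t next to that of x. *)
Definition coord_index J : Type := ('I_J * 'I_3 * 'I_3)%type.
HB.instance Definition _ J := Finite.on (coord_index J).

(** The gain of r ^- (2 j) over the plain average on a cell of side 2 ^ (j - l)
    is spent twice: one factor r ^- j makes the shares of the threshold
    summable in j, the other one makes the measures of the exceptional sets
    summable. *)
Definition cell_decay (g a tau r C : R) : Prop :=
  forall l J n x t, (0 < n)%N -> (l + 2 < J)%N ->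
    2 ^+ l <= tau * n%:R -> n%:R <= 2 * tau * 2 ^+ l ->
    - pi <= x <= pi -> - pi <= t <= pi ->
    exists q : coord_index J, let s := 2 ^+ q.1.1 / 2 ^+ l in
      Num.floor (t / s) =
        Num.floor ((x - period_shift q.1.2) / s) + unit_offset q.2 /\
      `|cos_kernel (riesz_coef g a n) n (x - t)| <= C / (s * (r ^+ 2) ^+ q.1.1).

Lemma riesz_kernel_cell (g a tau : R) : 1 <= g -> 0 < a -> 1 <= tau ->
  exists2 r : R, 1 < r & exists2 C : R, 0 < C & cell_decay g a tau r C.
Proof.
move=> g1 a0 t1; have [r r1 [C C0 H]] := riesz_kernel_dyadic g1 a0 t1.
exists r => //; exists C => // l J n x t n0 lJ nl ln xpi tpi.
have [e ue] := torus_shift xpi tpi.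
have [j jl [uj K]] := H l n _ n0 nl ln ue.
have jJ : (j < J)%N by rewrite (leq_trans jl)// -addn3 addnS.
have s0 : 0 < 2 ^+ j / 2 ^+ l :> R by rewrite divr_gt0// exprn_gt0.
have near : `|x - period_shift e - t| <= 2 ^+ j / 2 ^+ l.
  by rewrite ler_pdivlMr ?exprn_gt0// mulrC addrAC.
have [e' fe] := floor_near s0 near.
exists (Ordinal jJ, e, e') => /=; split=> //.
rewrite -(cos_kernel_period _ _ _ e).
rewrite ler_pdivlMr; last by rewrite mulr_gt0// !exprn_gt0// (lt_trans _ r1).
rewrite [X in _ * X](_ : _ = (2 * r ^+ 2) ^+ j / 2 ^+ l); last first.
  by rewrite [(2 * _) ^+ j]exprMn mulrAC.
by rewrite mulrA ler_pdivrMr ?exprn_gt0.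
Qed.

End kernel_cells.

Section maximal_cells.
Context {R : realType} {d : nat}.
Variable J : nat.
Implicit Types (p : {ffun 'I_d -> coord_index J}) (x t : d.-tuple R) (l : nat).

Definition pow_of p (i : 'I_d) : nat := (p i).1.1.
Definition shift_of p (i : 'I_d) : R := period_shift (p i).1.2.
Definition cell_of p l x : {ffun 'I_d -> int} :=
  [ffun i => Num.floor ((tnth x i - shift_of p i) / side (pow_of p) l i)
             + unit_offset (p i).2].

Lemma dilated_cell_of p l x :
  dilated_cell (pow_of p) (shift_of p) l (cell_of p l x) x.
Proof.
move=> i; rewrite /dilated_itv/= in_itv/= ffunE.
have s0 : 0 < side (pow_of p) l i :> R := side_gt0 _ _ _.
have /andP[h1 h2] := floor_itv ((tnth x i - shift_of p i) / side (pow_of p) l i).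
set K := Num.floor _ in h1 h2 *.
rewrite ler_pdivlMr// in h1; rewrite ltr_pdivrMr// in h2.
rewrite -lerBrDr -ltrBlDr; apply/andP; split.
  apply: le_trans h1; rewrite ler_pM2r// ler_int /unit_offset.
  have := ltn_ord (p i).2; lia.
apply: lt_le_trans h2 _; rewrite ler_pM2r// ler_int /unit_offset; lia.
Qed.

Variables r C : R.
Hypotheses (r1 : 1 < r) (C0 : 0 < C).

(** The normalization under which the weights sum to at most 1: it is the
    inverse of 9 times the sum of the geometric series of ratio 1 / r. *)
Definition weight_unit : R := (1 - r^-1) / 9.

(** The share of the threshold that is given to the cells of index p. *)
Definition weight p : R := \prod_i (weight_unit / r ^+ pow_of p i).

Let r0 : 0 < r. Proof. exact: lt_trans r1. Qed.

Lemma weight_unit_gt0 : 0 < weight_unit.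
Proof. by rewrite divr_gt0// subr_gt0 invf_lt1. Qed.

Lemma weight_gt0 p : 0 < weight p.
Proof. by apply: prodr_gt0 => i _; rewrite divr_gt0 ?weight_unit_gt0 ?exprn_gt0. Qed.

Lemma sum_weight : \sum_p weight p <= 1.
Proof.
rewrite /weight -(bigA_distr_bigA (fun _ (q : coord_index J) =>
  weight_unit / r ^+ q.1.1)) /=.
rewrite prodr_const card_ord exprn_ile1//.
  by apply: sumr_ge0 => q _; rewrite divr_ge0 ?exprn_ge0// ltW// weight_unit_gt0.
rewrite -(pair_bigA _ (fun (q : 'I_J * 'I_3) (_ : 'I_3) =>
  weight_unit / r ^+ q.1))/=.
under eq_bigr do rewrite sumr_const card_ord.
rewrite -(pair_bigA _ (fun (q : 'I_J) (_ : 'I_3) => (weight_unit / r ^+ q) *+ 3))/=.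
under eq_bigr do rewrite sumr_const card_ord.
have E : (1 - r^-1) * \sum_(k < J) r^-1 ^+ k = 1 - r^-1 ^+ J.
  by rewrite -opprB mulNr -subrX1 opprB.
rewrite (eq_bigr (fun k : 'I_J => (1 - r^-1) * r^-1 ^+ k)); last first.
  move=> k _; rewrite -mulrnA -mulr_natr /weight_unit exprVn.
  by rewrite mulrAC divfK.
by rewrite -mulr_sumr E gerBl exprn_ge0// invr_ge0 ltW.
Qed.

(** A pigeonhole principle: the integral of G is at most a sum over p of
    masses of cells, so that one of them exceeds its share rho * weight p.
    Since the kernel bound is of the order of the square of weight p divided
    by the volume of the cell, the average of F over that cell is then at
    least of the order of rho / weight p. *)
Lemma sum_cells (F : d.-tuple R -> R) (G : d.-tuple R -> R) (B rho : R) l x :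
  (forall t, 0 <= F t) -> measurable_fun torus F ->
  measurable_fun torus G -> (forall t, 0 <= G t) -> 0 < B -> 0 < rho ->
  (forall t, torus t -> exists2 p, cell (pow_of p) l (cell_of p l x) t &
     G t <= B * F t * \prod_i (C / (side (pow_of p) l i * (r ^+ 2) ^+ pow_of p i)))
  -> (rho%:E < \int[lebesgue_tuple d]_(t in torus) (G t)%:E)%E ->
  exists p, heavy F (pow_of p)
    (rho / B * (weight_unit ^+ 2 / C) ^+ d / weight p) l (cell_of p l x).
Proof.
move=> F0 mF mG G0 B0 rho0 HG; apply: contraPP => /forallNP nh.
apply/negP; rewrite -leNgt.
pose W p := B * \prod_i (C / (side (pow_of p) l i * (r ^+ 2) ^+ pow_of p i)).
have W0 p : 0 <= W p.
  rewrite mulr_ge0 ?(ltW B0)// prodr_ge0// => i _.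
  by rewrite divr_ge0 ?(ltW C0)// mulr_ge0 ?exprn_ge0 ?sqr_ge0// ltW// side_gt0.
have mT := @measurable_torus R d.
pose K p : set (d.-tuple R) := cell (pow_of p) l (cell_of p l x).
have mK p : measurable (K p) by exact: measurable_cell.
have mFK p : measurable_fun torus ((fun t => (F t)%:E) \_ (K p)).
  apply/(measurable_restrict _ (mK p) mT).
  apply: (@measurable_funS _ _ _ _ torus) => //; exact/measurable_EFinP.
pose H p t := ((W p)%:E * ((fun t => (F t)%:E) \_ (K p)) t)%E.
have mH p : measurable_fun torus (H p) by exact: measurable_funeM.
have Fr0 p t : (0 <= ((fun t => (F t)%:E) \_ (K p)) t)%E.
  by apply: erestrict_ge0 => y _; rewrite lee_fin.
have H0 p t : (0 <= H p t)%E by rewrite mule_ge0// lee_fin.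
apply: (@le_trans _ _ (\int[lebesgue_tuple d]_(t in torus) (\sum_p H p t))%E).
  apply: ge0_le_integral => //.
  - by move=> t _; rewrite lee_fin.
  - exact/measurable_EFinP.
  - exact: emeasurable_sum.
  - move=> t tt; have [p tp Gp] := HG t tt.
    apply: (@le_trans _ _ (H p t)).
      rewrite /H patchE mem_set// -EFinM lee_fin; apply: le_trans Gp _.
      by rewrite /W mulrAC.
    by rewrite (bigD1 p)//= leeDl//; apply: sume_ge0 => q _.
rewrite ge0_integral_sum//.
apply: (@le_trans _ _ (\sum_p (rho * weight p)%:E)%E); last first.
  by rewrite sumEFin lee_fin -mulr_sumr ler_piMr ?sum_weight// ltW.
apply: lee_sum => p _.
rewrite ge0_integralZl ?lee_fin//.
rewrite -integral_mkcondr -/(mass F _).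
have := nh p; rewrite /heavy => /negP; rewrite -leNgt => hp.
have W0' : (0 <= (W p)%:E)%E by rewrite lee_fin.
apply: le_trans (lee_wpmul2l W0' hp) _.
rewrite -EFinM lee_fin le_eqVlt; apply/orP; left; apply/eqP.
have wt0 := weight_gt0 p.
suff E : \prod_i (C / (side (pow_of p) l i * (r ^+ 2) ^+ pow_of p i))
    * (weight_unit ^+ 2 / C) ^+ d * \prod_i side (pow_of p) l i
    = weight p * weight p.
  rewrite /W.
  transitivity (rho / weight p * (\prod_i (C / (side (pow_of p) l i *
    (r ^+ 2) ^+ pow_of p i)) * (weight_unit ^+ 2 / C) ^+ d
    * \prod_i side (pow_of p) l i)).
    by field; rewrite (gt_eqF B0) gt_eqF.
  by rewrite E; field; rewrite gt_eqF.
have -> : (weight_unit ^+ 2 / C) ^+ d = \prod_(i < d) (weight_unit ^+ 2 / C).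
  by rewrite prodr_const card_ord.
rewrite /weight -!big_split/=; apply: eq_bigr => i _.
have s0 : side (pow_of p) l i != 0 :> R by rewrite gt_eqF// side_gt0.
have rj : r ^+ pow_of p i != 0 by rewrite expf_neq0// gt_eqF.
rewrite -exprM mulnC exprM; move: (r ^+ pow_of p i) rj => z z0.
by field; rewrite z0 s0 gt_eqF.
Qed.

End maximal_cells.

(** * Integrals of complex functions on the torus *)

Section complex_integral.
Context {R : realType} {d : nat}.
Local Notation mu := (@lebesgue_tuple R d).
Implicit Types (f g h : d.-tuple R -> R[i]) (z c : R[i]) (x t : d.-tuple R)
  (k : d.-tuple int).

Lemma complex_ReD z c : complex.Re (z + c) = complex.Re z + complex.Re c.
Proof. by case: z c => [? ?] []. Qed.

Lemma complex_ImD z c : complex.Im (z + c) = complex.Im z + complex.Im c.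
Proof. by case: z c => [? ?] []. Qed.

Lemma complex_ReM z c :
  complex.Re (z * c) = complex.Re z * complex.Re c - complex.Im z * complex.Im c.
Proof. by case: z c => [? ?] []. Qed.

Lemma complex_ImM z c :
  complex.Im (z * c) = complex.Re z * complex.Im c + complex.Im z * complex.Re c.
Proof. by case: z c => [? ?] []. Qed.

Lemma complex_ext z c : complex.Re z = complex.Re c ->
  complex.Im z = complex.Im c -> z = c.
Proof. by case: z c => [? ?] [? ?] /= -> ->. Qed.

Lemma L1_torusM f h (M : R) : L1_torus f ->
  measurable_fun setT (fun x => complex.Re (h x)) ->
  measurable_fun setT (fun x => complex.Im (h x)) ->
  (forall x, `|complex.Re (h x)| <= M) -> (forall x, `|complex.Im (h x)| <= M) ->
  L1_torus (fun x => f x * h x).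
Proof.
move=> [fr fi] mr mi Mr Mi; have mT := @measurable_torus R d.
have bd (u : d.-tuple R -> R) : (forall x, `|u x| <= M) ->
    [bounded u x | x in torus].
  move=> uM; exists M; split; first exact: num_real.
  by move=> N MN x _; rewrite /= (le_trans (uM x))// ltW.
have mr' := measurable_funTS (D := torus) mr.
have mi' := measurable_funTS (D := torus) mi.
split.
  rewrite (_ : (fun x => _) = (((fun x => (complex.Re (f x))%:E)
      \* (EFin \o (fun x => complex.Re (h x))))
    \- ((fun x => (complex.Im (f x))%:E)
      \* (EFin \o (fun x => complex.Im (h x)))))%E); last first.
    by apply/funext => x /=; rewrite complex_ReM EFinB !EFinM.
  by apply: integrableB => //; apply: integrableMl => //; exact: bd.
rewrite (_ : (fun x => _) = (((fun x => (complex.Re (f x))%:E)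
    \* (EFin \o (fun x => complex.Im (h x))))
  \+ ((fun x => (complex.Im (f x))%:E)
    \* (EFin \o (fun x => complex.Re (h x)))))%E); last first.
  by apply/funext => x /=; rewrite complex_ImM EFinD !EFinM.
by apply: integrableD => //; apply: integrableMl => //; exact: bd.
Qed.

Lemma L1_torusZ c f : L1_torus f -> L1_torus (fun x => c * f x).
Proof.
move=> fL; rewrite (_ : (fun x => _) = (fun x => f x * c)); last first.
  by apply/funext => x; rewrite mulrC.
apply: (@L1_torusM _ (fun=> c) (`|complex.Re c| + `|complex.Im c|)) => //.
- by move=> _; rewrite lerDl.
- by move=> _; rewrite lerDr.
Qed.

Lemma L1_torusD f g : L1_torus f -> L1_torus g -> L1_torus (fun x => f x + g x).
Proof.
move=> [fr fi] [gr gi]; have mT := @measurable_torus R d; split.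
  rewrite (_ : (fun x => _) = ((fun x => (complex.Re (f x))%:E)
    \+ (fun x => (complex.Re (g x))%:E))%E); first exact: integrableD.
  by apply/funext => x /=; rewrite complex_ReD EFinD.
rewrite (_ : (fun x => _) = ((fun x => (complex.Im (f x))%:E)
  \+ (fun x => (complex.Im (g x))%:E))%E); first exact: integrableD.
by apply/funext => x /=; rewrite complex_ImD EFinD.
Qed.

Lemma L1_torus0 : @L1_torus R d (fun=> 0).
Proof. by split; apply: integrable0. Qed.

Lemma torus_integralD f g : L1_torus f -> L1_torus g ->
  torus_integral (fun x => f x + g x) = torus_integral f + torus_integral g.
Proof.
move=> [fr fi] [gr gi]; have mT := @measurable_torus R d.
apply: complex_ext; rewrite /torus_integral ?complex_ReD ?complex_ImD/=.
  by rewrite -RintegralD//; apply: eq_Rintegral => x _; rewrite complex_ReD.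
by rewrite -RintegralD//; apply: eq_Rintegral => x _; rewrite complex_ImD.
Qed.

Lemma torus_integralZ c f : L1_torus f ->
  torus_integral (fun x => c * f x) = c * torus_integral f.
Proof.
move=> [fr fi]; have mT := @measurable_torus R d.
have iZ (y : R) (u : d.-tuple R -> R) : mu.-integrable torus (EFin \o u) ->
    mu.-integrable torus (EFin \o (fun x => y * u x)).
  move=> iu; rewrite (_ : _ \o _ = (fun x => y%:E * (EFin \o u) x)%E).
    exact: integrableZl.
  by apply/funext => x /=; rewrite EFinM.
apply: complex_ext; rewrite /torus_integral ?complex_ReM ?complex_ImM/=.
  rewrite -RintegralZl// -(RintegralZl _ _ fi)// -RintegralB//; try exact: iZ.
  by apply: eq_Rintegral => x _; rewrite complex_ReM.
rewrite -(RintegralZl _ _ fi)// -(RintegralZl _ _ fr)// -RintegralD//; try exact: iZ.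
by apply: eq_Rintegral => x _; rewrite complex_ImM.
Qed.

Lemma torus_integral_sum (I : Type) (s : seq I) (c : I -> R[i])
    (g : I -> d.-tuple R -> R[i]) : (forall i, L1_torus (g i)) ->
  L1_torus (fun x => \sum_(i <- s) c i * g i x) /\
  torus_integral (fun x => \sum_(i <- s) c i * g i x) =
  \sum_(i <- s) c i * torus_integral (g i).
Proof.
move=> gL; elim: s => [|i s [IH1 IH2]].
  rewrite big_nil (_ : (fun x => _) = (fun=> 0 : R[i])); last first.
    by apply/funext => x; rewrite big_nil.
  split; first exact: L1_torus0.
  rewrite -[X in torus_integral X](_ : (fun=> 0 * 0 : R[i]) = _).
    by rewrite (torus_integralZ 0 L1_torus0) mul0r.
  by apply/funext => x; rewrite mul0r.
rewrite big_cons (_ : (fun x => _) =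
    (fun x => c i * g i x + \sum_(i <- s) c i * g i x)); last first.
  by apply/funext => x; rewrite big_cons.
split; first by apply: L1_torusD => //; exact: L1_torusZ.
by rewrite torus_integralD// ?IH2 ?torus_integralZ//; exact: L1_torusZ.
Qed.

Lemma normcE z : normc z = Num.sqrt (complex.Re z ^+ 2 + complex.Im z ^+ 2).
Proof. by case: z. Qed.

Lemma normc_ge0 z : 0 <= normc z.
Proof. by rewrite normcE sqrtr_ge0. Qed.

Lemma normc_le z : normc z <= `|complex.Re z| + `|complex.Im z|.
Proof.
rewrite normcE -[leRHS]ger0_norm ?addr_ge0// -sqrtr_sqr ler_wsqrtr//.
rewrite sqrrD !real_normK ?num_real// -addrA lerD2l lerDr mulrn_wge0// mulr_ge0//.
Qed.

Lemma Re_le_normc z : `|complex.Re z| <= normc z.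
Proof. by rewrite normcE -sqrtr_sqr ler_wsqrtr// lerDl sqr_ge0. Qed.

Lemma Im_le_normc z : `|complex.Im z| <= normc z.
Proof. by rewrite normcE -sqrtr_sqr ler_wsqrtr// lerDr sqr_ge0. Qed.

Lemma normc_real (y : R) : normc (y%:C)%C = `|y|.
Proof. by rewrite normcE/= expr0n addr0 sqrtr_sqr. Qed.

Lemma measurable_normc D f : measurable D ->
  measurable_fun D (fun x => complex.Re (f x)) ->
  measurable_fun D (fun x => complex.Im (f x)) ->
  measurable_fun D (fun x => normc (f x)).
Proof.
move=> mD mr mi; rewrite (_ : (fun x => _) = Num.sqrt \o
  (fun x => complex.Re (f x) ^+ 2 + complex.Im (f x) ^+ 2)); last first.
  by apply/funext => x; rewrite normcE.
apply: (measurableT_comp (continuous_measurable_fun (@sqrt_continuous R))).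
by apply: measurable_funD; exact: measurable_funX.
Qed.

Lemma L1_torus_measurable f : L1_torus f ->
  measurable_fun torus (fun x => normc (f x)).
Proof.
move=> [/measurable_int/measurable_EFinP mr /measurable_int/measurable_EFinP mi].
by apply: measurable_normc => //; exact: measurable_torus.
Qed.

(** A triangle inequality up to a factor 2, which is harmless here and needs no
    rotation of the integral. *)
Lemma normc_torus_integral f : L1_torus f ->
  ((normc (torus_integral f))%:E <= \int[mu]_(t in torus)
     (`|complex.Re (f t)| + `|complex.Im (f t)|)%:E)%E.
Proof.
move=> [fr fi]; have mT := @measurable_torus R d.
have mr := measurable_int _ fr; have mi := measurable_int _ fi.
apply: (@le_trans _ _ (`|\int[mu]_(t in torus) (complex.Re (f t))%:E|
                     + `|\int[mu]_(t in torus) (complex.Im (f t))%:E|)%E).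
  rewrite -!EFin_normr_Rintegral// -EFinD lee_fin; exact: normc_le.
under [leRHS]eq_integral do rewrite EFinD.
rewrite ge0_integralD//; first last.
- by apply/measurable_EFinP/measurableT_comp => //; exact/measurable_EFinP.
- by apply/measurable_EFinP/measurableT_comp => //; exact/measurable_EFinP.
by apply: leeD; exact: le_abse_integral.
Qed.

End complex_integral.

(** * The Riesz means as convolutions *)

Section symmetric_range.
Implicit Types (n k : nat) (m : int).

Definition symrange n : seq int :=
  0 :: [seq (k.+1)%:Z | k <- iota 0 n] ++ [seq - (k.+1)%:Z | k <- iota 0 n].

Lemma mem_symrange n m : (m \in symrange n) = (absz m <= n)%N.
Proof.
rewrite inE mem_cat; apply/idP/idP.
  move=> /or3P[/eqP->//|/mapP[k]|/mapP[k]]; rewrite mem_iota => /andP[_ kn] ->;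
    lia.
case: m => [[|m]|m] mn; first by rewrite eqxx.
  apply/or3P; apply: Or32; apply/mapP; exists m => //; rewrite mem_iota; lia.
apply/or3P; apply: Or33; apply/mapP; exists m; last by rewrite NegzE.
by rewrite mem_iota; lia.
Qed.

Lemma uniq_symrange n : uniq (symrange n).
Proof.
rewrite /= mem_cat cat_uniq !map_inj_uniq ?iota_uniq ?andbT//=; first last.
- by move=> i j [].
- by move=> i j /oppr_inj [].
apply/andP; split.
  by apply/negP => /orP[] /mapP[k _].
by apply/hasPn => _ /mapP[k _ ->]; apply/negP => /mapP[l _]; lia.
Qed.

Lemma sum_symrange (V : nmodType) n (G : int -> V) :
  \sum_(m <- symrange n) G m =
  G 0 + \sum_(k < n) (G (k.+1)%:Z + G (- (k.+1)%:Z)).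
Proof.
rewrite big_cons big_cat/= !big_map -big_split/=.
rewrite -(big_mkord xpredT (fun k => G k.+1%:Z + G (- k.+1%:Z))).
by rewrite /index_iota subn0.
Qed.

End symmetric_range.

Section convolution.
Context {R : realType} {d : nat}.
Implicit Types (f : d.-tuple R -> R[i]) (x t : d.-tuple R) (k : d.-tuple int)
  (n : d.-tuple nat) (u v : R).

Lemma expiD u v : expi (u + v) = expi u * expi v.
Proof.
by apply: complex_ext; rewrite ?complex_ReM ?complex_ImM/= ?cosD ?sinD//; ring.
Qed.

Lemma expi0 : expi 0 = 1 :> R[i].
Proof. by rewrite /expi cos0 sin0. Qed.

Lemma expi_sum (I : Type) (s : seq I) (F : I -> R) :
  expi (\sum_(i <- s) F i) = \prod_(i <- s) expi (F i).
Proof. exact: (big_morph _ expiD expi0). Qed.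

Lemma measurable_dot k : measurable_fun setT (fun x : d.-tuple R => dot k x).
Proof.
apply: measurable_sum => i; apply: measurable_funM => //.
exact: measurable_tnth.
Qed.

Lemma measurable_cosT : measurable_fun setT (@cos R).
Proof. by apply: continuous_measurable_fun; exact: continuous_cos. Qed.

Lemma measurable_sinT : measurable_fun setT (@sin R).
Proof. by apply: continuous_measurable_fun; exact: continuous_sin. Qed.

Lemma L1_torus_expi f k : L1_torus f ->
  L1_torus (fun t => f t * expi (- dot k t)).
Proof.
move=> fL; apply: (@L1_torusM _ _ _ _ 1) => //=.
- apply: (measurableT_comp measurable_cosT); apply: measurableT_comp => //.
  exact: measurable_dot.
- apply: (measurableT_comp measurable_sinT); apply: measurableT_comp => //.
  exact: measurable_dot.
- by move=> x; exact: cos_max.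
- by move=> x; exact: sin_max.
Qed.

Definition int_box n : set (d.-tuple int) :=
  [set k | forall i, (`|tnth k i| <= tnth n i)%N].

(** The multi-indices in the box are the positions in the lists of their
    coordinates; the common bound W turns the box into a finite family of
    functions, over which products of sums distribute. *)
Lemma int_box_enum n : exists2 W : nat,
  (forall i, size (symrange (tnth n i)) <= W)%N &
  forall k, int_box n k <-> exists2 p : {ffun 'I_d -> 'I_W},
    p \in family (fun i (b : 'I_W) => (b < size (symrange (tnth n i)))%N) &
    [tuple nth 0 (symrange (tnth n i)) (p i) | i < d] = k.
Proof.
exists (\max_i size (symrange (tnth n i))).
  by move=> i; exact: (leq_bigmax i).
move=> k; split=> [kn|[p /familyP pQ <-] i]; last first.
  by rewrite tnth_mktuple -mem_symrange mem_nth//; exact: pQ.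
have lt i : (index (tnth k i) (symrange (tnth n i)) <
    size (symrange (tnth n i)))%N by rewrite index_mem mem_symrange kn.
have ltW i : (index (tnth k i) (symrange (tnth n i)) <
    \max_i size (symrange (tnth n i)))%N.
  by apply: leq_trans (lt i) _; exact: (leq_bigmax i).
exists [ffun i => Ordinal (ltW i)].
  by apply/familyP => i; rewrite ffunE; exact: lt.
apply: eq_from_tnth => i; rewrite tnth_mktuple ffunE/= nth_index//.
by rewrite mem_symrange kn.
Qed.

Lemma finite_int_box n : finite_set (int_box n).
Proof.
have [W _ E] := int_box_enum n.
apply: (@sub_finite_set _ _ ((fun p : {ffun 'I_d -> 'I_W} =>
  [tuple nth 0 (symrange (tnth n i)) (p i) | i < d]) @` setT)).
  by move=> k /E[p _ <-]; exists p.
by apply: finite_image; exact: finite_finset.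
Qed.

Lemma sum_int_box n (G : 'I_d -> int -> R[i]) :
  \sum_(k \in int_box n) \prod_i G i (tnth k i) =
  \prod_i \sum_(m <- symrange (tnth n i)) G i m.
Proof.
have [W HW E] := int_box_enum n.
pose Q i (b : 'I_W) := (b < size (symrange (tnth n i)))%N.
pose h (p : {ffun 'I_d -> 'I_W}) : d.-tuple int :=
  [tuple nth 0 (symrange (tnth n i)) (p i) | i < d].
transitivity (\prod_i \sum_(b < W | Q i b) G i (nth 0 (symrange (tnth n i)) b));
  last first.
  apply: eq_bigr => i _; rewrite [RHS](big_nth 0) big_mkord.
  by rewrite (big_ord_widen _ (fun b => G i (nth 0 (symrange (tnth n i)) b)) (HW i)).
rewrite bigA_distr_big_dep fsbig_finite; last exact: finite_int_box.
rewrite (perm_big [seq h p | p in family Q]); last first.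
  apply: uniq_perm; first exact: finmap.fset_uniq.
    rewrite map_inj_in_uniq ?enum_uniq// => p q.
    rewrite !mem_enum => /familyP pQ /familyP qQ pq; apply/ffunP => i.
    apply/val_inj/eqP.
    rewrite -(nth_uniq 0 (pQ i) (qQ i) (uniq_symrange _)).
    move/(congr1 (fun w : d.-tuple int => tnth w i)): pq.
    by rewrite !tnth_mktuple => ->.
  move=> k; rewrite in_fset_set; last exact: finite_int_box.
  apply/idP/idP.
    rewrite inE => /E[p pQ <-].
    by apply/mapP; exists p; rewrite ?mem_enum.
  move=> /mapP[p]; rewrite mem_enum => pQ ->.
  by rewrite inE; apply/E; exists p.
rewrite big_image/=; apply: eq_bigr => p _; apply: eq_bigr => i _.
by rewrite tnth_mktuple.
Qed.

Variables (g a : R).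
Hypotheses (g1 : 1 <= g) (a0 : 0 < a).

Definition riesz_factor (n : nat) (m : int) : R :=
  (1 - (`|m%:~R| / n%:R) `^ g) `^ a.

Lemma riesz_factorE (n : nat) (m : int) : (0 < n)%N -> (absz m <= n)%N ->
  riesz_factor n m = riesz_coef g a n (absz m).
Proof.
move=> n0 mn; rewrite (riesz_coefE (lt_le_trans ltr01 g1) a0 n0 mn).
by rewrite /riesz_factor -intr_norm natr_absz.
Qed.

Lemma sum_riesz_factor (n : nat) u : (0 < n)%N ->
  \sum_(m <- symrange n) (riesz_factor n m)%:C%C * expi (m%:~R * u) =
  (cos_kernel (riesz_coef g a n) n u)%:C%C.
Proof.
move=> n0; have E0 : expi (0%:~R * u) = 1 :> R[i].
  by rewrite mulr0z (mul0r u) expi0.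
have -> : (cos_kernel (riesz_coef g a n) n u)%:C%C = (riesz_coef g a n 0)%:C%C
    + \sum_(k < n) (2 * (riesz_coef g a n k.+1 * cos (k.+1%:R * u)))%:C%C.
  by rewrite /cos_kernel mulr_sumr rmorphD rmorph_sum.
rewrite sum_symrange; congr (_ + _).
  by rewrite (@riesz_factorE n 0 n0 (leq0n n)) E0; exact: mulr1.
apply: eq_bigr => k _.
have kn : (absz k.+1%:Z <= n)%N by rewrite absz_nat ltn_ord.
have kn' : (absz (- k.+1%:Z)%R <= n)%N by rewrite abszN.
rewrite (riesz_factorE n0 kn) (riesz_factorE n0 kn') abszN absz_nat.
rewrite mulrNz mulNr -pmulrn; move: (riesz_coef _ _ _ _) (_ * u) => y v.
apply: complex_ext; rewrite ?complex_ReD ?complex_ImD ?complex_ReM ?complex_ImM.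
  by rewrite /= ?cosN ?sinN; ring.
by rewrite /= ?cosN ?sinN; ring.
Qed.

Lemma riesz_mean_convolution f n x : L1_torus f -> (forall i, 0 < tnth n i)%N ->
  let h := fun t => f t * (\prod_i cos_kernel
      (riesz_coef g a (tnth n i)) (tnth n i) (tnth x i - tnth t i))%:C%C in
  L1_torus h /\ riesz_mean g a n f x = ((2 * pi) ^- d)%:C%C * torus_integral h.
Proof.
move=> fL n0 h.
pose c k : R[i] := (\prod_i riesz_factor (tnth n i) (tnth k i))%:C%C * expi (dot k x).
pose s := finmap.enum_fset (fset_set (int_box n)).
have [sL sE] := torus_integral_sum s c (fun k => L1_torus_expi k fL).
have hE : h = (fun t => \sum_(k <- s) c k * (f t * expi (- dot k t))).
  apply/funext => t; rewrite /h.
  under [RHS]eq_bigr do rewrite mulrCA; rewrite -mulr_sumr; congr (_ * _).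
  rewrite rmorph_prod/=.
  under eq_bigr do rewrite -sum_riesz_factor//.
  rewrite -(sum_int_box n (fun i m => (riesz_factor (tnth n i) m)%:C%C *
    expi (m%:~R * (tnth x i - tnth t i)))).
  rewrite fsbig_finite; last exact: finite_int_box.
  apply: eq_bigr => k _; rewrite big_split/= -rmorph_prod/= /c -mulrA.
  congr (_ * _); rewrite -expi_sum -expiD; congr expi.
  by rewrite /dot -sumrB; apply: eq_bigr => i _; rewrite mulrBr.
split; first by rewrite hE.
rewrite hE sE mulr_sumr /riesz_mean fsbig_finite; last exact: finite_int_box.
apply: eq_bigr => k _; rewrite /fourier_coef /c /riesz_factor.
ring.
Qed.

(** The factor 2 is that of the triangle inequality for complex integrals, and
    (2 pi) ^ - d is at most 1. *)
Lemma riesz_mean_bound f n x : L1_torus f -> (forall i, 0 < tnth n i)%N ->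
  exists G : d.-tuple R -> R, [/\ measurable_fun torus G, forall t, 0 <= G t,
    forall t, G t <= 2 * normc (f t) * \prod_i `|cos_kernel
      (riesz_coef g a (tnth n i)) (tnth n i) (tnth x i - tnth t i)| &
    ((normc (riesz_mean g a n f x))%:E
      <= \int[lebesgue_tuple d]_(t in torus) (G t)%:E)%E].
Proof.
move=> fL n0; have [hL E] := riesz_mean_convolution x fL n0.
set h := (fun t => _) in hL E.
exists (fun t => `|complex.Re (h t)| + `|complex.Im (h t)|); split.
- case: hL => /measurable_int/measurable_EFinP mr.
  move=> /measurable_int/measurable_EFinP mi.
  by apply: measurable_funD; apply: measurableT_comp.
- by move=> t; rewrite addr_ge0.
- move=> t; apply: (@le_trans _ _ (2 * normc (h t))).
    by rewrite mulr_natl mulr2n lerD ?Re_le_normc ?Im_le_normc.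
  by rewrite /h normcM normc_real normr_prod mulrA.
apply: le_trans (normc_torus_integral hL); rewrite lee_fin E normcM normc_real.
rewrite ler_piMl ?normc_ge0// ger0_norm; last first.
  by rewrite invr_ge0 exprn_ge0// mulr_ge0// pi_ge0.
rewrite invf_le1 ?exprn_gt0 ?mulr_gt0 ?pi_gt0// exprn_ege1//.
by have := pi_ge2 R; lra.
Qed.

Lemma measurable_riesz_mean f n (D : set (d.-tuple R)) : measurable D ->
  measurable_fun D (fun x => normc (riesz_mean g a n f x)).
Proof.
move=> mD; pose c k : R[i] := (\prod_i riesz_factor (tnth n i) (tnth k i))%:C%C
  * fourier_coef f k.
pose s := finmap.enum_fset (fset_set (int_box n)).
have E x : riesz_mean g a n f x = \sum_(k <- s) c k * expi (dot k x).
  by rewrite /riesz_mean fsbig_finite//; exact: finite_int_box.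
have mc k : measurable_fun D (fun x => cos (dot k x)).
  apply: measurable_funTS; apply: (measurableT_comp measurable_cosT).
  exact: measurable_dot.
have ms k : measurable_fun D (fun x => sin (dot k x)).
  apply: measurable_funTS; apply: (measurableT_comp measurable_sinT).
  exact: measurable_dot.
apply: measurable_normc => //.
  rewrite (_ : (fun x => _) = (fun x => \sum_(k <- s) (complex.Re (c k) *
    cos (dot k x) - complex.Im (c k) * sin (dot k x)))); last first.
    apply/funext => x; rewrite E (big_morph _ complex_ReD (erefl : complex.Re 0 = 0)).
    by apply: eq_bigr => k _; exact: complex_ReM.
  apply: measurable_sum => k.
  by apply: measurable_funB; apply: measurable_funM.
rewrite (_ : (fun x => _) = (fun x => \sum_(k <- s) (complex.Re (c k) *
  sin (dot k x) + complex.Im (c k) * cos (dot k x)))); last first.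
  apply/funext => x; rewrite E (big_morph _ complex_ImD (erefl : complex.Im 0 = 0)).
  by apply: eq_bigr => k _; exact: complex_ImM.
apply: measurable_sum => k.
by apply: measurable_funD; apply: measurable_funM.
Qed.

End convolution.

(** * The maximal operator *)

Section weak_type.
Context {R : realType} {d : nat}.
Local Notation mu := (@lebesgue_tuple R d).
Variables (g tau a r C : R) (i0 : 'I_d).
Hypotheses (g1 : 1 <= g) (a0 : 0 < a) (tau1 : 1 <= tau) (r1 : 1 < r) (C0 : 0 < C).
Hypothesis kernel_cell : cell_decay g a tau r C.

Implicit Types (f : d.-tuple R -> R[i]) (n : d.-tuple nat) (x t : d.-tuple R)
  (rho : R) (L : nat).

Definition in_cone n := cone tau [tuple (tnth n i)%:R | i < d].

(** The dyadic size of n.  One coordinate is enough, since those of a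
    multi-index in the cone are comparable. *)
Definition scale n : nat := trunc_log 2 (tnth n i0).

Lemma in_cone_gt0 n i : in_cone n -> (0 < tnth n i)%N.
Proof. by move=> [/(_ i)]; rewrite tnth_mktuple ltr0n. Qed.

Lemma in_cone_scale n i : in_cone n ->
  2 ^+ scale n <= tau * (tnth n i)%:R /\ (tnth n i)%:R <= 2 * tau * 2 ^+ scale n.
Proof.
move=> nc; have ni := in_cone_gt0 i nc; have n0 := in_cone_gt0 i0 nc.
have [_ h] := nc.
have h1 := h i0 i; have h2 := h i i0; rewrite !tnth_mktuple in h1 h2.
have p1 : 2 ^+ scale n <= (tnth n i0)%:R :> R.
  by rewrite -natrX ler_nat trunc_logP.
have p2 : (tnth n i0)%:R <= 2 * 2 ^+ scale n :> R.
  by rewrite -exprS -natrX ler_nat ltnW// trunc_log_ltn.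
have t0 : 0 < tau by exact: lt_le_trans tau1.
move: h1 h2 => /andP[_ h1] /andP[_ h2].
rewrite ler_pdivrMr ?ltr0n// in h1; rewrite ler_pdivrMr ?ltr0n// in h2.
split; first exact: le_trans h1.
apply: le_trans h2 _; rewrite mulrAC mulrC.
by rewrite mulrC [leRHS]mulrC ler_pM2l.
Qed.

(** Bounding the scale leaves finitely many grids and finitely many shapes of
    cells, so that finite unions suffice. *)
Definition level_set f L rho : set (d.-tuple R) :=
  [set x | torus x /\ exists n, [/\ in_cone n, (scale n < L)%N &
                                    rho < normc (riesz_mean g a n f x)]].

Lemma level_set_heavy f L rho x : L1_torus f -> 0 < rho -> level_set f L rho x ->
  exists (p : {ffun 'I_d -> coord_index L.+2}) l, (l < L)%N /\
    heavy (fun t => normc (f t)) (pow_of p)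
      (rho / 2 * (weight_unit r ^+ 2 / C) ^+ d / weight r p) l (cell_of p l x).
Proof.
move=> fL rho0 [xT [n [nc nL hx]]].
have n0 i := in_cone_gt0 i nc.
have [G [mG G0 GF Gx]] := riesz_mean_bound g1 a0 x fL n0.
have [||||||||p hp] := @sum_cells R d L.+2 r C r1 C0 (fun t => normc (f t)) G 2 rho
  (scale n) x; last by exists p, (scale n).
- by move=> t; exact: normc_ge0.
- exact: L1_torus_measurable.
- exact: mG.
- exact: G0.
- by [].
- by [].
- move=> t tT.
  have lL : (scale n + 2 < L.+2)%N by rewrite addn2 !ltnS.
  have [q Hq] := fin_all_exists (fun i : 'I_d =>
    let h := in_cone_scale i nc in
    kernel_cell (n0 i) lL h.1 h.2 (xT i) (tT i)).
  exists [ffun i => q i].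
    by move=> i; rewrite ffunE /side /pow_of /shift_of ffunE; have [] := Hq i.
  apply: le_trans (GF t) _; rewrite ler_wpM2l ?mulr_ge0 ?normc_ge0//.
  apply: ler_prod => i _; rewrite normr_ge0/= /side /pow_of ffunE.
  by have [] := Hq i.
- by apply: lt_le_trans Gx; rewrite lte_fin.
Qed.

(** The average over a heavy cell of index p is at least of the order of
    rho / weight p, so that its exceptional set has measure of the order of
    weight p / rho times the norm of f, and the weights sum to at most 1. *)
Lemma level_set_cover f L rho : L1_torus f -> 0 < rho -> exists Y,
  [/\ measurable Y, level_set f L rho `<=` Y &
    (mu Y <= (2 * (3 * (C / weight_unit r ^+ 2)) ^+ d / rho)%:E * L1_norm f)%E].
Proof.
move=> fL rho0; have k0 := weight_unit_gt0 r1.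
pose T := {ffun 'I_d -> coord_index L.+2}.
pose w (p : T) := rho / 2 * (weight_unit r ^+ 2 / C) ^+ d / weight r p.
have w0 p : 0 < w p.
  by rewrite !divr_gt0 ?weight_gt0// mulr_gt0 ?exprn_gt0 ?divr_gt0// exprn_gt0.
have cov (p : T) := @cover_heavy R d (fun t => normc (f t)) (pow_of p) (shift_of p)
  (fun t => normc_ge0 (f t)) (L1_torus_measurable fL) (w p) L (w0 p).
have [Y HY] := choice cov.
have mY p : measurable (Y p) by have [] := HY p.
exists (\bigcup_(p in [set` enum T]) Y p); split.
- by apply: fin_bigcup_measurable => //; exact: finite_finset.
- move=> x /(level_set_heavy fL rho0)[p [l [lL hp]]].
  exists p; first by rewrite /= mem_enum.
  have [_ sub _] := HY p; apply: (sub l _ x lL hp).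
  exact: dilated_cell_of.
apply: (@le_trans _ _ (\sum_(p \in [set` enum T]) mu (Y p))%E).
  apply: content_sub_fsum => //.
  by apply: fin_bigcup_measurable => //; exact: finite_finset.
rewrite -fsbig_seq ?enum_uniq// big_enum/=.
have N0 : (0 <= L1_norm f)%E.
  by apply: integral_ge0 => t _; rewrite lee_fin normc_ge0.
apply: (@le_trans _ _ (\sum_(p : T) (3 ^+ d / w p)%:E * L1_norm f)%E).
  apply: lee_sum => p _; have [_ _] := HY p.
  by rewrite /mass setIT.
rewrite -ge0_sume_distrl; last first.
  by move=> p _; rewrite lee_fin divr_ge0 ?exprn_ge0// ltW.
apply: lee_wpmul2r => //; rewrite sumEFin lee_fin.
rewrite (eq_bigr (fun p => 2 * (3 * (C / weight_unit r ^+ 2)) ^+ d / rho * weight r p)).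
  rewrite -mulr_sumr ler_piMr ?sum_weight//.
  rewrite divr_ge0 ?(ltW rho0)// mulr_ge0// exprn_ge0// mulr_ge0//.
  by rewrite divr_ge0 ?sqr_ge0// ltW.
move=> p _; rewrite /w; have wp := weight_gt0 r1 p.
rewrite -[C / _]invf_div.
have v0 : 0 < weight_unit r ^+ 2 / C by rewrite divr_gt0// exprn_gt0.
move: (weight_unit r ^+ 2 / C) (weight r p) v0 wp => v y v0 y0.
rewrite [(3 * _) ^+ d]exprMn exprVn; have := exprn_gt0 d v0.
move: (v ^+ d) (3 ^+ d) => u z u0.
by field; rewrite !gt_eqF.
Qed.

Lemma measurable_level_set f L rho : measurable (level_set f L rho).
Proof.
have mT := @measurable_torus R d.
pose A n := torus `&` [set x | (rho%:E < (normc (riesz_mean g a n f x))%:E)%E].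
rewrite (_ : level_set f L rho = \bigcup_n
    (if `[< in_cone n /\ (scale n < L)%N >] then A n else set0)).
  apply: countable_bigcupT_measurable => [|n]; first exact: countableP.
  case: ifP => // _; apply: measurable_lte => //.
  by apply/measurable_EFinP; exact: measurable_riesz_mean.
apply/seteqP; split=> x.
  move=> [xT [n [nc nL hx]]]; exists n => //.
  by rewrite asboolT//; split.
move=> [n _]; case: asboolP => // -[nc nL] [xT hx].
by split=> //; exists n; split.
Qed.

Lemma level_set_maximal f rho : \bigcup_L level_set f L rho =
  torus `&` [set x | (rho%:E < riesz_maximal g a tau f x)%E].
Proof.
apply/seteqP; split=> x.
  move=> [L _ [xT [n [nc _ hx]]]]; split=> //=.
  apply: (@lt_le_trans _ _ (normc (riesz_mean g a n f x))%:E).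
    by rewrite lte_fin.
  by apply: ereal_sup_ubound; exists n.
move=> [xT /= /ereal_sup_gt[_ [n nc <-]]]; rewrite lte_fin => hx.
by exists (scale n).+1 => //; split=> //; exists n; split.
Qed.

(** The bound does not depend on L, hence passes to the increasing union. *)
Lemma maximal_weak_type f rho : L1_torus f -> 0 < rho ->
  (rho%:E * mu (torus `&` [set x | (rho%:E < riesz_maximal g a tau f x)%E])
   <= (2 * (3 * (C / weight_unit r ^+ 2)) ^+ d)%:E * L1_norm f)%E.
Proof.
move=> fL rho0; rewrite -level_set_maximal.
set K := 2 * _ ^+ d.
have -> : (K%:E * L1_norm f = rho%:E * ((K / rho)%:E * L1_norm f))%E.
  by rewrite muleA -EFinM; congr (_%:E * _)%E; field; rewrite gt_eqF.
apply: lee_wpmul2l; first by rewrite lee_fin ltW.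
have mL L := measurable_level_set f L rho.
have cvgL : mu (level_set f L rho) @[L --> \oo] --> mu (\bigcup_L level_set f L rho).
  apply: nondecreasing_cvg_mu => //; first exact: bigcupT_measurable.
  move=> L M LM; apply/subsetPset => x [xT [n [nc nL hx]]].
  by split=> //; exists n; split=> //; exact: leq_trans LM.
rewrite -(cvg_lim _ cvgL)//; apply: lime_le.
  by apply/cvg_ex; eexists; exact: cvgL.
apply: nearW => L; have [Y [mY LY muY]] := level_set_cover L fL rho0.
by apply: le_trans muY; apply: le_measure; rewrite ?inE.
Qed.

End weak_type.

Unset Implicit Arguments.

Theorem corollary14p3 (R : realType) (d : nat) (gamma tau alpha : R)
    (d_ge1 : (1 <= d)%N) (gamma_ge1 : 1 <= gamma) (tau_ge1 : 1 <= tau)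
    (alpha_gt0 : 0 < alpha) :
  exists C : R, forall f : d.-tuple R -> R[i], L1_torus f ->
    (ereal_sup
       [set rho%:E * lebesgue_tuple d
          (torus `&` [set x | rho%:E < riesz_maximal gamma alpha tau f x])
       | rho in [set rho : R | (0 < rho)%R]]
     <= C%:E * L1_norm f)%E.
Proof.
have [r r1 [C C0 H]] := riesz_kernel_cell gamma_ge1 alpha_gt0 tau_ge1.
exists (2 * (3 * (C / weight_unit r ^+ 2)) ^+ d) => f fL.
apply: ub_ereal_sup => _ [rho rho0 <-].
exact: (maximal_weak_type (Ordinal d_ge1) gamma_ge1 alpha_gt0 tau_ge1 r1 C0 H).
Qed.
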